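(* Let $d\in\mathbb{N}$ and let $\Delta$ be a Borel random variable on $\mathbb{R}^d$. Let $(\Delta_i)_{i\in\mathbb{N}}$ be independent copies of $\Delta$. Set $X_1=\Delta_1$ and, for every $n\geq 2$, let $U_n$ be uniform on $\{1,\dots,n-1\}$ (independent of everything else) and $X_n=X_{U_n}+\Delta_n$. Let $\mu_n:=\sum_{i=1}^n\delta_{X_i}$. Assume there exist $\alpha>0$ and a random variable $\Lambda$ on $\mathbb{R}^d$, with law $\mathcal L(\Lambda)$, such that $n^{-\alpha}\sum_{i=1}^n\Delta_i$ converges in distribution to $\Lambda$ as $n\to\infty$. Then almost surely, as $n\to\infty$, $\Theta_{\log(n)^{\alpha}}(\mu_n/n)$ converges weakly to $\mathcal L(\Lambda)$.
   Context: For $a>0$ and a finite Borel measure $\mu$ on $\mathbb{R}^d$, $\Theta_a(\mu)$ denotes the unique Borel measure such that $\Theta_a(\mu)(B/a)=\mu(B)$ for every Borel set $B\subset\mathbb{R}^d$ (i.e. the image of $\mu$ under $x\mapsto x/a$). *)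

(* Defs.v *)
From HB Require Import structures.
From mathcomp Require Import all_boot all_order all_algebra.
From mathcomp Require Import finmap.
From mathcomp Require Import all_classical all_reals all_analysis.
Set Implicit Arguments. Unset Strict Implicit. Unset Printing Implicit Defensive.
Import Order.TTheory GRing.Theory Num.Theory.
Import numFieldNormedType.Exports.
Local Open Scope classical_set_scope.
Local Open Scope ring_scope.

Definition Rd (R : realType) (d : nat) := g_sigma_algebraType (@open 'rV[R]_d).

Definition mutually_independent {dT} {T : measurableType dT} {R : realType}
  (P : probability T R) {I : choiceType} (E : I -> set (set T)) : Prop :=
  forall (J : {fset I}) (A : I -> set T),
    (forall j, j \in J -> E j (A j)) ->
    P (\bigcap_(j in [set` J]) A j) = (\prod_(j <- J) P (A j))%E.

Definition events_of {dT dV} {T : measurableType dT} {V : measurableType dV}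
  (X : T -> V) : set (set T) :=
  [set X @^-1` B | B in [set B : set V | measurable B]].

(* The recursive construction: given the values delta_i = Delta_i(w) and
   u_n = U_n(w), Xseq delta u n = [:: X_1; ...; X_n] where X_1 = delta_1 and
   X_n = X_{u_n} + delta_n for n >= 2. (If u_n is not in {1,..,n-1}, an event
   of probability zero, X_{u_n} is read as 0.) *)
Fixpoint Xseq {R : realType} {d : nat} (delta : nat -> 'rV[R]_d) (u : nat -> nat)
  (n : nat) : seq 'rV[R]_d :=
  match n with
  | 0 => [::]
  | n'.+1 =>
    let s := Xseq delta u n' in
    rcons s (if n' is 0 then delta 1%N
             else nth 0 s (u n'.+1).-1 + delta n'.+1)
  end.

Definition Xval {R : realType} {d : nat} (delta : nat -> 'rV[R]_d) (u : nat -> nat)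
  (n : nat) : 'rV[R]_d := nth 0 (Xseq delta u n) n.-1.

Definition empirical {R : realType} {d : nat} (x : nat -> 'rV[R]_d) (n : nat)
  : set (Rd R d) -> \bar R :=
  fun A => (\sum_(1 <= i < n.+1) \d_(x i : Rd R d) A)%E.

Definition mdiv {R : realType} {T} (mu : set T -> \bar R) (c : R) : set T -> \bar R :=
  fun A => ((c^-1)%:E * mu A)%E.

Definition Theta {R : realType} {d : nat} (a : R) (mu : set (Rd R d) -> \bar R)
  : set (Rd R d) -> \bar R :=
  pushforward mu ((fun x : 'rV[R]_d => a^-1 *: x) : Rd R d -> Rd R d).

Definition weak_cvg {R : realType} {d : nat} (mu : nat -> set (Rd R d) -> \bar R)
  (nu : set (Rd R d) -> \bar R) : Prop :=
  forall f : 'rV[R]_d -> R, continuous f -> (exists M : R, forall x, `|f x| <= M) ->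
    (fun n => \int[mu n]_(x in [set: Rd R d]) (f x)%:E)%E @ \oo --> (\int[nu]_(x in [set: Rd R d]) (f x)%:E)%E.

(* Main.v *)
(* For |f| <= 1, let Q f x = E f(x + Delta) and M_n f = (1/n) sum_(i <= n) f(X_i). Conditionally
   on the first n steps, f(X_(n+1)) has mean M_n (Q f); hence, for fixed n, with
   G_n = f and G_j = (j G_(j+1) + Q G_(j+1)) / (j + 1), the sequence j |-> M_j G_j
   is a martingale with increments bounded by 2 / (j + 1), and Azuma's inequality
   gives P(|M_n f - M_k G_k| >= eta) <= 2 exp(- eta^2 k / 32). With k = (log n)^2
   this is summable in n. Moreover G_k is a mixture of the Q^D f, where D is a sum
   of independent Bernoulli(1/j), k < j <= n, so D is concentrated around log n and
   G_k(0) at scale (log n)^alpha converges to E f(Lambda). It remains to neglect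
   the first k positions, i.e. to show that M_k min(1, |x| / (log n)^alpha) -> 0.
   Since k <= (log n)^2, this follows from M_n min(1, |x| / n^(alpha/2)) -> 0,
   which is the same argument with a larger scale: there, a crude polynomial bound
   in k on the first k positions suffices. That bound comes from the tail of Delta,
   which tightness of n^(-alpha) sum Delta_i controls through Ottaviani's
   inequality. Finally, weak convergence is tested on the countably many finite
   maxima of tent functions with rational parameters, which approximate any
   nonnegative continuous function from below. *)
Require Import Defs.
From HB Require Import structures.
From mathcomp Require Import all_boot all_order all_algebra.
From mathcomp Require Import finmap.
From mathcomp Require Import all_classical all_reals all_analysis.
From mathcomp Require Import measurable_realfun ring lra.
Set Implicit Arguments. Unset Strict Implicit. Unset Printing Implicit Defensive.
Import Order.TTheory GRing.Theory Num.Theory.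
Import numFieldNormedType.Exports.
Local Open Scope classical_set_scope.
Local Open Scope ring_scope.

(** * Bounded Lipschitz functions *)

Section BoundedLipschitz.
Variables (R : realType) (d : nat).
Local Notation V := 'rV[R]_d.
Implicit Types (f g : V -> R).

(** [Delta] is not assumed to have moments, so the positions near the root have no direct bound at
    the scale (log n)^alpha. Two constraints fix k: Azuma's exponent is a small multiple of k and
    must beat 2 log n, while the part log k missing from the mean of D must be o(log n); k = (log
    n)^2 meets both. The exponent alpha / 2 is then forced from both sides: k^(alpha/2) must not
    exceed (log n)^alpha, and n^(alpha/2) still beats every power of log n, so one round of
    bootstrapping is enough. The transition operator sees the law of [Delta] only as a positive
    normalized linear functional on bounded Lipschitz functions. It commutes with translations and
    therefore preserves every modulus of continuity; this uniformity in the number of steps is what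
    allows G_k to be replaced by G_k(0) on the first k positions at the cost of an average of
    [cap]. *)

Definition bl f := (exists M : R, forall x, `|f x| <= M) /\
  (exists C : R, forall x y, `|f x - f y| <= C * `|x - y|).

Lemma bl_cst (c : R) : bl (fun=> c).
Proof. by split; [exists `|c| | exists 0 => x y; rewrite subrr normr0 mul0r]. Qed.

Lemma bl_lin (a : R) f g : bl f -> bl g -> bl (fun x => a * f x + g x).
Proof.
move=> [[M fM] [C fC]] [[N gN] [D gD]]; split.
  exists (`|a| * M + N) => x; rewrite (le_trans (ler_normD _ _))// normrM.
  by rewrite lerD// ler_wpM2l.
exists (`|a| * C + D) => x y.
have -> : a * f x + g x - (a * f y + g y) = a * (f x - f y) + (g x - g y) by ring.
rewrite (le_trans (ler_normD _ _))// normrM mulrDl lerD// -mulrA.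
by rewrite ler_wpM2l.
Qed.

Lemma bl_ext f g : (forall x, f x = g x) -> bl f -> bl g.
Proof. by move=> /funext ->. Qed.

Lemma bl_sub f g : bl f -> bl g -> bl (fun x => f x - g x).
Proof.
move=> bf bg; apply: bl_ext (bl_lin (-1) bg bf) => x; ring.
Qed.

Lemma bl_scaled (a : R) f : bl f -> bl (fun x => a * f x).
Proof. by move=> bf; apply: bl_ext (bl_lin a bf (bl_cst 0)) => x; rewrite addr0. Qed.

Lemma bl_compl f : bl f -> bl (fun x => 1 - f x).
Proof. exact/bl_sub/bl_cst. Qed.

Lemma bl_mul f g : bl f -> bl g -> bl (fun x => f x * g x).
Proof.
move=> [[M fM] [C fC]] [[N gN] [D gD]]; split.
  by exists (M * N) => x; rewrite normrM ler_pM.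
exists (C * N + M * D) => x y.
have -> : f x * g x - f y * g y = (f x - f y) * g x + f y * (g x - g y) by ring.
rewrite (le_trans (ler_normD _ _))// !normrM mulrDl.
by rewrite [C * N * _]mulrAC -[M * D * _]mulrA lerD// ler_pM.
Qed.

Lemma bl_shift (x : V) f : bl f -> bl (fun y => f (x + y)).
Proof.
move=> [[M fM] [C fC]]; split; first by exists M.
by exists C => y z; rewrite (le_trans (fC _ _))// opprD addrACA subrr add0r.
Qed.

Lemma bl_dilate (r : R) f : bl f -> bl (fun x => f (r *: x)).
Proof.
move=> [[M fM] [C fC]]; split; first by exists M.
exists (C * `|r|) => x y; rewrite (le_trans (fC _ _))// -scalerBr normrZ.
by rewrite mulrA.
Qed.

Lemma bl_continuous f : bl f -> continuous f.
Proof.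
move=> [_ [C fC]] x.
have ? := @nbhs_filter V x; apply/cvgrPdist_lt => e e0.
have C0 : 0 < `|C| + 1 by rewrite ltr_wpDl.
have d0 : 0 < e / (`|C| + 1) by rewrite divr_gt0.
apply: filterS (nbhsx_ballx x _ d0).
move=> y; rewrite -ball_normE/= ltr_pdivlMr// mulrC => xy.
rewrite (le_lt_trans (fC _ _))// (le_lt_trans _ xy)// ler_wpM2r//.
by rewrite (le_trans (ler_norm _))// lerDl.
Qed.

(** A bounded substitute for the norm, which need not be integrable: smallness of its mean expresses
    smallness in probability. *)
Definition cap (x : V) : R := Num.min 1 `|x|.

Lemma cap_ge0 x : 0 <= cap x.
Proof. by rewrite le_min ler01/=. Qed.

Lemma cap_le1 x : cap x <= 1.
Proof. by rewrite ge_min lexx. Qed.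

Lemma cap_le_norm x : cap x <= `|x|.
Proof. by rewrite ge_min lexx orbT. Qed.

Lemma cap_modulus x y : `|cap x - cap y| <= cap (x - y).
Proof.
have := ler_normB x y; have := lerB_dist x y; have := lerB_dist y x.
rewrite (distrC y x) /cap ler_norml => h1 h2 h3.
have := normr_ge0 x; have := normr_ge0 y.
by case: (leP 1 `|x|) => ?; case: (leP 1 `|y|) => ?; case: (leP 1 `|x - y|) => ? ? ?;
  apply/andP; split; lra.
Qed.

Lemma cap_scale_le (r s : R) x : 0 <= r <= s -> cap (r *: x) <= cap (s *: x).
Proof.
move=> /andP[r0 rs]; rewrite /cap !normrZ !ger0_norm ?(le_trans r0)//.
by rewrite le_min ge_min lexx/= ge_min ler_wpM2r ?orbT.
Qed.

Lemma bl_cap : bl cap.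
Proof.
split; first by exists 1 => x; rewrite ger0_norm ?cap_ge0 ?cap_le1.
by exists 1 => x y; rewrite mul1r (le_trans (cap_modulus _ _))// cap_le_norm.
Qed.

(** Far pairs are paid for by [2 * M], near ones by the Lipschitz constant. Errors made on any test
    function thus reduce to the single function [cap]. *)
Lemma bl_modulus f : bl f ->
  exists2 B : R, 0 < B & forall x y, `|f x - f y| <= B * cap (x - y).
Proof.
move=> [[M fM] [C fC]].
have M0 : 0 <= M by rewrite (le_trans _ (fM 0)).
exists (2 * M + `|C| + 1); first by rewrite ltr_wpDl// addr_ge0// mulr_ge0.
move=> x y; rewrite /cap; case: (leP 1 `|x - y|) => _.
  rewrite mulr1 (le_trans (ler_normB _ _))//.
  have := fM x; have := fM y; have := normr_ge0 C; lra.
rewrite (le_trans (fC _ _))// ler_wpM2r//.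
have := ler_norm C; lra.
Qed.

(* [ramp t] vanishes on the ball of radius [t] and is [1] outside the ball of
   radius [2 t]. *)
Definition ramp (t : R) (x : V) : R := Num.min 1 (Num.max 0 (`|x| / t - 1)).

Lemma ramp_ge0 t x : 0 <= ramp t x.
Proof. by rewrite le_min ler01/= le_max lexx. Qed.

Lemma ramp_le1 t x : ramp t x <= 1.
Proof. by rewrite ge_min lexx. Qed.

Lemma ramp_eq0 t x : 0 < t -> `|x| <= t -> ramp t x = 0.
Proof.
move=> t0 xt; rewrite /ramp max_l ?min_r//.
by rewrite subr_le0 ler_pdivrMr// mul1r.
Qed.

Lemma ramp_eq1 t x : 0 < t -> 2 * t <= `|x| -> ramp t x = 1.
Proof.
move=> t0 xt; have : 2 <= `|x| / t by rewrite ler_pdivlMr.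
by move=> h; rewrite /ramp max_r ?min_l//; lra.
Qed.

Lemma ramp_le_cap t x : 0 < t -> ramp t x <= cap (t^-1 *: x).
Proof.
move=> t0; rewrite /cap normrZ gtr0_norm ?invr_gt0// mulrC /ramp.
have : 0 <= `|x| / t by rewrite divr_ge0// ltW.
move: (`|x| / t) => u u0.
by case: (leP 0 (u - 1)) => ?; rewrite /Num.min; repeat case: ifP => ?; lra.
Qed.

Lemma bl_ramp t : 0 < t -> bl (ramp t).
Proof.
move=> t0; split; first by exists 1 => x; rewrite ger0_norm ?ramp_ge0 ?ramp_le1.
exists t^-1 => x y.
have : `| `|x| / t - `|y| / t | <= t^-1 * `|x - y|.
  rewrite -mulrBl normrM (@gtr0_norm _ t^-1) ?invr_gt0// mulrC.
  by rewrite ler_pM2l ?invr_gt0// ler_dist_dist.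
apply: le_trans; rewrite /ramp ler_norml.
move: (`|x| / t) (`|y| / t) => u v.
have := ler_norm (u - v); have := ler_norm (v - u); rewrite (distrC v u) => h1 h2.
have := normr_ge0 (u - v).
by case: (leP 0 (u - 1)) => ?; case: (leP 0 (v - 1)) => ?; rewrite /Num.min;
  repeat case: ifP => ?; move=> ?; apply/andP; split; lra.
Qed.

End BoundedLipschitz.

(** * Mixtures along sums of Bernoulli variables *)

Section Mixture.
Variable R : realType.
Implicit Types (a b : nat -> R) (k m : nat).

(** Average over one Bernoulli variable of parameter [1 / k.+1]: the step count [e] grows by one
    with that probability. *)
Definition bern k a : nat -> R := fun e => (k%:R * a e + a e.+1) / k.+1%:R.

(* [mixop k m a e] is the expectation of [a (e + D)], where [D] is a sum of
   independent Bernoulli variables of parameters [1 / (k + i)], [1 <= i <= m]. *)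
Fixpoint mixop k m a : nat -> R :=
  if m is m'.+1 then bern k (mixop k.+1 m' a) else a.

Lemma mixop_le k m a b : (forall e, a e <= b e) ->
  forall e, mixop k m a e <= mixop k m b e.
Proof.
move=> ab; elim: m k => [//|m IH] k e /=; rewrite /bern ler_pM2r ?invr_gt0//.
by rewrite lerD ?IH// ler_wpM2l ?IH.
Qed.

Lemma mixop_lin k m c a b e :
  mixop k m (fun e => c * a e + b e) e = c * mixop k m a e + mixop k m b e.
Proof. by elim: m k e => [//|m IH] k e /=; rewrite /bern !IH; ring. Qed.

Lemma mixop_cst k m c e : mixop k m (fun=> c) e = c.
Proof.
elim: m k e => [//|m IH] k e /=; rewrite /bern !IH -[X in _ + X]mul1r -mulrDl natr1.
by rewrite mulrC mulKf.
Qed.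

Lemma mixop_dist k m a b c e : (forall e, `|a e - b e| <= c) ->
  `|mixop k m a e - mixop k m b e| <= c.
Proof.
move=> abc.
rewrite -[leRHS](mixop_cst k m c e) ler_norml; apply/andP; split.
  rewrite mixop_cst lerBrDr -[X in X + _](mixop_cst k m (- c) e).
  rewrite -[X in X + _]mul1r -mixop_lin; apply: mixop_le => i.
  by have := abc i; rewrite ler_norml => /andP[? ?]; lra.
rewrite lerBlDr -[X in X + _]mul1r -mixop_lin; apply: mixop_le => i.
by have := abc i; rewrite ler_norml => /andP[? ?]; lra.
Qed.

(** The mean of the variable D of [mixop k m], a segment of the harmonic series. *)
Fixpoint hsum k m : R := if m is m'.+1 then k.+1%:R^-1 + hsum k.+1 m' else 0.

(** Squared bias plus variance: a Bernoulli variable of parameter [p] has variance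
    [p - p ^+ 2 <= p], so the variance of the sum is at most its mean. The slack [p ^+ 2] is what
    remains at the end of the induction step. *)
Lemma mixop_sqr k m (mu : R) e :
  mixop k m (fun e => (e%:R - mu) ^+ 2) e <= (e%:R + hsum k m - mu) ^+ 2 + hsum k m.
Proof.
elim: m k e => [|m IH] k e /=; first by rewrite !addr0.
rewrite /bern; apply: (@le_trans _ _
  ((k%:R * ((e%:R + hsum k.+1 m - mu) ^+ 2 + hsum k.+1 m) +
   ((e.+1%:R + hsum k.+1 m - mu) ^+ 2 + hsum k.+1 m)) / k.+1%:R)).
  by rewrite ler_pM2r ?invr_gt0// lerD ?IH// ler_wpM2l ?IH.
set h := hsum k.+1 m; set p : R := k.+1%:R^-1.
have p0 : 0 < p by rewrite invr_gt0.
have kp : k%:R * p = 1 - p.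
  have : (k%:R + 1) * p = 1 by rewrite natr1 divff.
  by rewrite mulrDl mul1r => /(canRL (addrK _)).
rewrite -(natr1 e) mulrDl mulrAC kp -subr_ge0.
move: p h {IH p0 kp} => p h.
have -> : (e%:R + (p + h) - mu) ^+ 2 + (p + h) -
  ((1 - p) * ((e%:R + h - mu) ^+ 2 + h) + ((e%:R + 1 + h - mu) ^+ 2 + h) * p)
  = p ^+ 2 by ring.
exact: sqr_ge0.
Qed.

(** Chebyshev's inequality in functional form: the parabola pays for the values of [e] far from
    [mu], and its mean is bounded by [mixop_sqr]. *)
Lemma mixop_concentration k m a (c eta B mu : R) :
  (forall e, `|a e - c| <= eta + B * (e%:R - mu) ^+ 2) -> 0 <= B ->
  `|mixop k m a 0 - c| <= eta + B * ((hsum k m - mu) ^+ 2 + hsum k m).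
Proof.
move=> H B0.
have S := mixop_sqr k m mu 0; rewrite add0r in S.
have /(ler_wpM2l B0) S' := S.
rewrite ler_norml; apply/andP; split.
  have := @mixop_le k m (fun e => - B * (e%:R - mu) ^+ 2 + (c - eta)) a _ 0%N.
  rewrite mixop_lin mixop_cst => h; have {}h := h _; rewrite lerBrDr.
  apply: le_trans (h _); first by lra.
  by move=> e; have := H e; rewrite ler_norml => /andP[? ?]; lra.
have := @mixop_le k m a (fun e => B * (e%:R - mu) ^+ 2 + (c + eta)) _ 0%N.
rewrite mixop_lin mixop_cst => h; rewrite lerBlDr.
apply: le_trans (h _) _; last by lra.
by move=> e; have := H e; rewrite ler_norml => /andP[? ?]; lra.
Qed.

Lemma ln_le_sub1 (x : R) : 0 < x -> ln x <= x - 1.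
Proof.
move=> x0; rewrite -ler_expR lnK//.
by have := expR_ge1Dx (x - 1); rewrite addrC subrK.
Qed.

Lemma hsum_le k m : (0 < k)%N -> hsum k m <= ln (k + m)%:R - ln k%:R.
Proof.
elim: m k => [|m IH] k k0 /=; first by rewrite addn0 subrr.
have := IH k.+1 (ltn0Sn _); rewrite addSnnS => h.
have k0' : 0 < k%:R :> R by rewrite ltr0n.
have := @ln_le_sub1 (k%:R / k.+1%:R) (divr_gt0 k0' (ltr0Sn _ _)).
rewrite ln_div ?posrE//.
have -> : k%:R / k.+1%:R - 1 = - k.+1%:R^-1 :> R.
  by rewrite -natr1; field; rewrite natr1.
move: h; move: (ln (k + m.+1)%:R) (ln k%:R) (ln k.+1%:R) (k.+1%:R^-1) (hsum _ _).
move=> *; lra.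
Qed.

Lemma hsum_ge k m : ln (k + m).+1%:R - ln k.+1%:R <= hsum k m.
Proof.
elim: m k => [|m IH] k /=; first by rewrite addn0 subrr.
have := IH k.+1; rewrite addSnnS => h.
have := @ln_le_sub1 (k.+2%:R / k.+1%:R) (divr_gt0 (ltr0Sn _ _) (ltr0Sn _ _)).
rewrite ln_div ?posrE//.
have -> : k.+2%:R / k.+1%:R - 1 = k.+1%:R^-1 :> R.
  by rewrite -(natr1 k.+1) mulrDl divff// mul1r addrAC subrr add0r.
move: h; move: (ln (k + m.+1).+1%:R) (ln k.+2%:R) (ln k.+1%:R) (k.+1%:R^-1) (hsum _ _).
move=> *; lra.
Qed.

Lemma hsum_ln_dist k n : (0 < k <= n)%N ->
  `|hsum k (n - k) - ln n%:R| <= 1 + ln k%:R.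
Proof.
move=> /andP[k0 kn]; have n0 : (0 < n)%N by exact: leq_trans kn.
have := hsum_le (n - k) k0; have := hsum_ge k (n - k); rewrite subnKC// => h1 h2.
have lk : 0 <= ln k%:R :> R by rewrite ln_ge0// ler1n.
have ln1 : ln n%:R <= ln n.+1%:R :> R by rewrite ler_ln ?posrE ?ltr0n// ler_nat.
have lk1 : ln k.+1%:R <= ln k%:R + 1 :> R.
  have k0' : 0 < k%:R :> R by rewrite ltr0n.
  have := @ln_le_sub1 (k.+1%:R / k%:R) (divr_gt0 (ltr0Sn _ _) k0').
  rewrite ln_div ?posrE// -(natr1 k) mulrDl divff ?gt_eqF// mul1r.
  have : k%:R^-1 <= 1 :> R by rewrite invf_le1// ler1n.
  by rewrite natr1; lra.
rewrite ler_norml; apply/andP; split; lra.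
Qed.

End Mixture.

(** * Transition operator of the random walk *)

Section Walk.
Variables (R : realType) (d : nat).
Local Notation V := 'rV[R]_d.
Implicit Types (f g : V -> R).

(** An expectation restricted to [bl] functions, so that the transition operator can be iterated
    with no measurability condition. *)
Definition is_mean (E : (V -> R) -> R) := [/\
  forall a f g, bl f -> bl g -> E (fun x => a * f x + g x) = a * E f + E g,
  forall f g, bl f -> bl g -> (forall x, f x <= g x) -> E f <= E g &
  forall c, E (fun=> c) = c].

Variable E : (V -> R) -> R.
Hypothesis E_mean : is_mean E.

Definition tr f : V -> R := fun x => E (fun y => f (x + y)).
Definition trn n f : V -> R := iter n tr f.

Lemma mean_lin a f g : bl f -> bl g -> E (fun x => a * f x + g x) = a * E f + E g.
Proof. by case: E_mean => h _ _; exact: h. Qed.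

Lemma mean_le f g : bl f -> bl g -> (forall x, f x <= g x) -> E f <= E g.
Proof. by case: E_mean => _ h _; exact: h. Qed.

Lemma mean_cst c : E (fun=> c) = c.
Proof. by case: E_mean => _ _ h; exact: h. Qed.

Lemma mean_scale a f : bl f -> E (fun x => a * f x) = a * E f.
Proof.
move=> bf; rewrite -[RHS]addr0 -[in RHS](mean_cst 0) -mean_lin//; last exact: bl_cst.
by congr E; apply/funext => x; rewrite addr0.
Qed.

Lemma mean_compl f : bl f -> E (fun x => 1 - f x) = 1 - E f.
Proof.
move=> bf; have := mean_lin (-1) bf (bl_cst _ 1); rewrite mean_cst => h.
rewrite [RHS](_ : _ = -1 * E f + 1); last by ring.
by rewrite -h; congr E; apply/funext => x; ring.
Qed.

Lemma mean_dist f g c : bl f -> bl g -> (forall x, `|f x - g x| <= c) ->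
  `|E f - E g| <= c.
Proof.
move=> bf bg fgc; rewrite ler_norml; apply/andP; split.
  rewrite lerBrDr -[X in X + _](mean_cst (- c)) -[X in X + _]mul1r.
  rewrite -mean_lin//; last exact: bl_cst.
  apply: mean_le => //; first exact/bl_lin/bg/bl_cst.
  by move=> x; have := fgc x; rewrite ler_norml => /andP[? ?]; lra.
rewrite lerBlDr -[X in X + _](mean_cst c) -[X in X + _]mul1r.
rewrite -mean_lin//; last exact: bl_cst.
apply: mean_le => //; first exact/bl_lin/bg/bl_cst.
by move=> x; have := fgc x; rewrite ler_norml => /andP[? ?]; lra.
Qed.

(** The translation cancels in [(x + z) - (y + z)], so a modulus depending only on the difference is
    inherited without loss. It is applied both to [C * |x|] and to rescaled [cap]. *)
Lemma tr_modulus (w : V -> R) f : bl f ->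
  (forall x y, `|f x - f y| <= w (x - y)) ->
  forall x y, `|tr f x - tr f y| <= w (x - y).
Proof.
move=> bf fw x y; apply: mean_dist; [exact: bl_shift..|] => z.
by rewrite (le_trans (fw _ _))// opprD addrACA subrr addr0.
Qed.

Lemma tr_bounded f M : bl f -> (forall x, `|f x| <= M) -> forall x, `|tr f x| <= M.
Proof.
move=> bf fM x; rewrite -[tr f x]subr0 -[X in _ - X](mean_cst 0).
by apply: mean_dist => [| |y]; [exact: bl_shift|exact: bl_cst|rewrite subr0].
Qed.

Lemma bl_tr f : bl f -> bl (tr f).
Proof.
move=> bf; have [[M fM] [C fC]] := bf; split; first by exists M; exact: tr_bounded.
by exists C; exact: (tr_modulus (w := fun x => C * `|x|)).
Qed.

Lemma bl_trn n f : bl f -> bl (trn n f).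
Proof. by move=> bf; elim: n => //= n IH; exact: bl_tr. Qed.

Lemma trn_modulus (w : V -> R) f : bl f ->
  (forall x y, `|f x - f y| <= w (x - y)) ->
  forall n x y, `|trn n f x - trn n f y| <= w (x - y).
Proof.
by move=> bf fw; elim => //= n IH; apply: tr_modulus => //; exact: bl_trn.
Qed.

Lemma trn_bounded f M : bl f -> (forall x, `|f x| <= M) ->
  forall n x, `|trn n f x| <= M.
Proof.
by move=> bf fM; elim => //= n IH; apply: tr_bounded => //; exact: bl_trn.
Qed.

Lemma tr_lin a f g x : bl f -> bl g ->
  tr (fun x => a * f x + g x) x = a * tr f x + tr g x.
Proof. by move=> bf bg; rewrite /tr mean_lin//; exact: bl_shift. Qed.

Lemma tr_scale a f x : bl f -> tr (fun x => a * f x) x = a * tr f x.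
Proof. by move=> bf; rewrite /tr -mean_scale//; exact: bl_shift. Qed.

Lemma trn_le n f g : bl f -> bl g -> (forall x, f x <= g x) ->
  forall x, trn n f x <= trn n g x.
Proof.
move=> bf bg fg; elim: n => //= n IH x.
by apply: mean_le => [| |y]; [exact/bl_shift/bl_trn..|exact: IH].
Qed.

Lemma trn_cst n c x : trn n (fun=> c) x = c.
Proof.
elim: n x => //= n IH x; rewrite /tr -[RHS]mean_cst; congr E.
by apply/funext => y; exact: IH.
Qed.

Lemma trn_compl n f x : bl f -> trn n (fun x => 1 - f x) x = 1 - trn n f x.
Proof.
move=> bf; elim: n x => //= n IH x; rewrite -mean_compl; last exact/bl_shift/bl_trn.
by congr E; apply/funext => y; exact: IH.
Qed.

Lemma trn_shift n f x z : trn n (fun y => f (z + y)) x = trn n f (z + x).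
Proof.
elim: n x => //= n IH x; rewrite /tr; congr E; apply/funext => y.
by rewrite -[LHS]/(trn _ _ _) IH addrA.
Qed.

(** The function G_k of the overview, with [n = k + m]. *)
Definition mixtr k m f : V -> R := fun x => mixop k m (fun e => trn e f x) 0.

Lemma bl_mixop k m f e : bl f -> bl (fun x => mixop k m (fun e => trn e f x) e).
Proof.
move=> bf; elim: m k e => [|m IH] k e /=; first exact: bl_trn.
apply: bl_ext (bl_lin (k%:R / k.+1%:R) (IH k.+1 e) (bl_scaled k.+1%:R^-1 (IH k.+1 e.+1))).
by move=> x; rewrite /bern; ring.
Qed.

Lemma bl_mixtr k m f : bl f -> bl (mixtr k m f).
Proof. exact: bl_mixop. Qed.

Lemma tr_mixop k m f e x : bl f ->
  tr (fun x => mixop k m (fun e => trn e f x) e) x =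
  mixop k m (fun e => trn e f x) e.+1.
Proof.
move=> bf; elim: m k e => [//|m IH] k e /=.
have b0 := bl_mixop k.+1 m e bf; have b1 := bl_mixop k.+1 m e.+1 bf.
transitivity (tr (fun x => k%:R / k.+1%:R * mixop k.+1 m (fun e => trn e f x) e +
    k.+1%:R^-1 * mixop k.+1 m (fun e => trn e f x) e.+1) x).
  by congr tr; apply/funext => y; rewrite /bern; ring.
rewrite tr_lin//; last exact: bl_scaled.
by rewrite tr_scale// !IH /bern; ring.
Qed.

(** [tr] raises the step count by one, hence averaging over the Bernoulli variable of parameter
    [1 / k.+1] is the backward recursion that makes the averages a martingale. *)
Lemma mixtrS k m f x : bl f ->
  mixtr k m.+1 f x = (k%:R * mixtr k.+1 m f x + tr (mixtr k.+1 m f) x) / k.+1%:R.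
Proof. by move=> bf; rewrite tr_mixop. Qed.

Lemma mixtr_bounded k m f M : bl f -> (forall x, `|f x| <= M) ->
  forall x, `|mixtr k m f x| <= M.
Proof.
move=> bf fM x; rewrite -[mixtr _ _ _ _]subr0 -[0 in leLHS](mixop_cst k m 0 0).
by apply: mixop_dist => e; rewrite subr0; exact: trn_bounded.
Qed.

Lemma mixtr_modulus (w : V -> R) k m f : bl f ->
  (forall x y, `|f x - f y| <= w (x - y)) ->
  forall x y, `|mixtr k m f x - mixtr k m f y| <= w (x - y).
Proof. by move=> bf fw x y; apply: mixop_dist => e; exact: trn_modulus. Qed.

(* Ottaviani's inequality: [surv m] is a smoothed version of the probability
   that the walk stays in a ball of radius of order [t] up to time [m]. *)
Section Ottaviani.
Variable t : R.
Hypothesis t0 : 0 < t.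

Let chi (x : V) : R := 1 - ramp (4 * t) x.

Fixpoint surv m : V -> R :=
  if m is m'.+1 then fun x => chi x * tr (surv m') x else fun=> 1.

Let t4 : 0 < 4 * t. Proof. by rewrite mulr_gt0. Qed.
Let t16 : 0 < 16 * t. Proof. by rewrite mulr_gt0. Qed.

Let bl_chi : bl chi. Proof. exact/bl_compl/bl_ramp. Qed.

Let chi_ge0 x : 0 <= chi x. Proof. by rewrite subr_ge0 ramp_le1. Qed.
Let chi_le1 x : chi x <= 1. Proof. by rewrite gerBl ramp_ge0. Qed.

Lemma bl_surv m : bl (surv m).
Proof. by elim: m => [|m IH] /=; [exact: bl_cst|exact/bl_mul/bl_tr]. Qed.

Lemma surv_ge0 m x : 0 <= surv m x.
Proof.
elim: m x => [//|m IH] x /=; rewrite mulr_ge0// -(mean_cst 0).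
by apply: mean_le => [| |y]; [exact: bl_cst|exact/bl_shift/bl_surv|exact: IH].
Qed.

(** From a point of norm below [8 * t], a step longer than [16 * t] lands where the cutoff vanishes,
    so each step costs a factor [1 - E (ramp (16 * t))]. The exponent is [m] because [m.+1]
    positions are joined by [m] steps. *)
Lemma surv_le m x : surv m.+1 x <= (1 - E (ramp (16 * t))) ^+ m.
Proof.
elim: m x => [|m IH] x.
  by rewrite expr0 /= /tr mean_cst mulr1.
have p1 : 0 <= 1 - E (ramp (16 * t)).
  rewrite subr_ge0 -[leRHS](mean_cst 1).
  by apply: mean_le => [| |y]; [exact: bl_ramp|exact: bl_cst|exact: ramp_le1].
change (chi x * tr (surv m.+1) x <= (1 - E (ramp (16 * t))) ^+ m.+1).
have [x8|x8] := leP (8 * t) `|x|.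
  by rewrite /chi ramp_eq1// ?subrr ?mul0r ?exprn_ge0//; lra.
apply: (@le_trans _ _ (tr (surv m.+1) x)).
  rewrite ler_piMl// -(mean_cst 0).
  by apply: mean_le => [| |y]; [exact: bl_cst|exact/bl_shift/bl_surv|exact: surv_ge0].
rewrite exprSr -[X in _ <= _ * X]mean_compl; last exact: bl_ramp.
rewrite -mean_scale; last exact/bl_compl/bl_ramp.
apply: mean_le => [| |y].
- exact/bl_shift/bl_surv.
- exact/bl_scaled/bl_compl/bl_ramp.
have [y16|y16] := leP `|y| (16 * t).
  by rewrite ramp_eq0// subr0 mulr1; exact: IH.
have xy : 8 * t <= `|x + y|.
  by have := ler_normB (x + y) x; rewrite addrC addKr; lra.
change (chi (x + y) * tr (surv m) (x + y) <=
  (1 - E (ramp (16 * t))) ^+ m * (1 - ramp (16 * t) y)).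
rewrite [chi _](_ : _ = 0); last by rewrite /chi ramp_eq1 ?subrr//; lra.
by rewrite mul0r mulr_ge0 ?exprn_ge0// subr_ge0 ramp_le1.
Qed.

(** Once [4 * t <= |x|], the remaining walk moves by less than [2 * t] with probability at least one
    half, and then ends where [ramp t] is 1. As long as [|x| < 4 * t], the cutoff is 1 and the
    induction passes to the next step. *)
Lemma ottaviani m : (forall l, (l <= m)%N -> trn l (ramp t) 0 <= 2^-1) ->
  forall x, 2^-1 * (1 - surv m x) <= trn m (ramp t) x.
Proof.
have br := bl_ramp d t0.
elim: m => [_ x|m IH half x]; first by rewrite subrr mulr0 ramp_ge0.
have [x4|x4] := leP (4 * t) `|x|.
  apply: (@le_trans _ _ 2^-1).
    by rewrite ler_piMr ?invr_ge0// gerBl surv_ge0.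
  apply: (@le_trans _ _ (1 - trn m.+1 (ramp t) 0)); first by have := half m.+1 (leqnn _); lra.
  rewrite -trn_compl// -[X in _ <= trn _ _ X]addr0 -trn_shift.
  apply: trn_le => [| |y]; [exact: bl_compl|exact: bl_shift|].
  have [y2|y2] := leP (2 * t) `|y|; first by rewrite ramp_eq1// subrr ramp_ge0.
  rewrite (@ramp_eq1 _ _ _ (x + y))//; first by rewrite gerBl ramp_ge0.
  by have := ler_normB (x + y) y; rewrite addrK; lra.
rewrite /= [chi x](_ : _ = 1); last by rewrite /chi ramp_eq0 ?subr0// ltW.
rewrite mul1r -mean_compl; last exact/bl_shift/bl_surv.
rewrite -mean_scale; last exact/bl_compl/bl_shift/bl_surv.
apply: mean_le => [| |y].
- exact/bl_scaled/bl_compl/bl_shift/bl_surv.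
- exact/bl_shift/bl_trn.
- by apply: IH => l lm; apply: half; exact: leqW.
Qed.

(* The walk leaves the ball as soon as one step is large, so a large one-step
   tail contradicts Ottaviani's inequality. *)
Lemma one_step_tail m : (forall l, (l <= m.+1)%N -> trn l (ramp t) 0 <= 4^-1) ->
  m%:R * E (ramp (16 * t)) <= 1.
Proof.
move=> quarter; set p := E _.
have half l : (l <= m.+1)%N -> trn l (ramp t) 0 <= 2^-1.
  by move=> /quarter; lra.
have /andP[p0 p1] : 0 <= p <= 1.
  apply/andP; split; [rewrite -[leLHS](mean_cst 0)|rewrite -[leRHS](mean_cst 1)];
  by apply: mean_le => *; rewrite ?ramp_ge0 ?ramp_le1//; (exact: bl_ramp || exact: bl_cst).
have h1 := ottaviani half 0; have h2 := surv_le m 0; have h3 := quarter _ (leqnn m.+1).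
have h4 : 2^-1 <= (1 - p) ^+ m by move: h1 h2 h3; rewrite -/p; lra.
(* Multiplying [h4] by [(1 + p) ^+ m] brings in Bernoulli's inequality, which gives [m p <= 1]
   without logarithms. *)
have h5 : (1 - p) ^+ m * (1 + p) ^+ m <= 1.
  rewrite -exprMn exprn_ile1//; first by rewrite mulr_ge0; lra.
  have -> : (1 - p) * (1 + p) = 1 - p * p by ring.
  by rewrite gerBl mulr_ge0.
have h6 : 1 + m%:R * p <= (1 + p) ^+ m.
  elim: m {quarter half h1 h2 h3 h4 h5} => [|m IH]; first by rewrite mul0r addr0 expr0.
  rewrite exprS -natr1; apply: (@le_trans _ _ ((1 + p) * (1 + m%:R * p))).
    have : 0 <= m%:R * p * p by rewrite !mulr_ge0.
    lra.
  by rewrite ler_wpM2l//; lra.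
have h7 : (1 + p) ^+ m <= 2.
  have := ler_wpM2r (_ : 0 <= (1 + p) ^+ m) h4 => h; have {}h := h _.
  suff : 2^-1 * (1 + p) ^+ m <= 1 by lra.
  apply: le_trans h5; apply: h; rewrite exprn_ge0//; lra.
lra.
Qed.

End Ottaviani.
End Walk.

(** * Expectation of bounded variables *)

Section BoundedMeasurable.
Context d (T : measurableType d) (R : realType).
Implicit Types f g : T -> R.

Definition bm f := measurable_fun [set: T] f /\ exists M, forall w, `|f w| <= M.

Lemma bm_cst (c : R) : bm (fun=> c).
Proof. by split; [exact: measurable_cst|exists `|c|]. Qed.

Lemma bm_add f g : bm f -> bm g -> bm (fun w => f w + g w).
Proof.
move=> [mf [M fM]] [mg [N gN]]; split; first exact: measurable_funD.
by exists (M + N) => w; rewrite (le_trans (ler_normD _ _))// lerD.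
Qed.

Lemma bm_mul f g : bm f -> bm g -> bm (fun w => f w * g w).
Proof.
move=> [mf [M fM]] [mg [N gN]]; split; first exact: measurable_funM.
by exists (M * N) => w; rewrite normrM ler_pM.
Qed.

Lemma bm_scale (c : R) f : bm f -> bm (fun w => c * f w).
Proof. by move=> bf; apply: bm_mul => //; exact: bm_cst. Qed.

Lemma bm_sub f g : bm f -> bm g -> bm (fun w => f w - g w).
Proof.
move=> bf bg; have /(bm_add bf) := bm_scale (-1) bg.
by congr bm; apply/funext => w; rewrite mulN1r.
Qed.

Lemma bm_sum (I : Type) (r : seq I) (Q : pred I) (F : I -> T -> R) :
  (forall i, Q i -> bm (F i)) -> bm (fun w => \sum_(i <- r | Q i) F i w).
Proof.
move=> bF; elim: r => [|i r IH].
  by under eq_fun do rewrite big_nil; exact: bm_cst.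
case: (boolP (Q i)) => [Qi|/negbTE Qi]; under eq_fun do rewrite big_cons Qi //.
  by apply: bm_add => //; exact: bF.
exact: IH.
Qed.

Lemma bm_expR f : bm f -> bm (fun w => expR (f w)).
Proof.
move=> [mf [M fM]]; split; first exact: measurableT_comp.
exists (expR M) => w; rewrite ger0_norm ?expR_ge0// ler_expR.
exact: le_trans (ler_norm _) (fM w).
Qed.

Lemma bm_indic (A : set T) : measurable A -> bm (\1_A : T -> R).
Proof.
move=> mA; split; first exact: measurable_indic.
by exists 1 => w; rewrite indicE ger0_norm// lern1 leq_b1.
Qed.

End BoundedMeasurable.

Lemma bm_comp d1 (T1 : measurableType d1) d2 (T2 : measurableType d2) (R : realType)
    (h : T1 -> T2) (f : T2 -> R) :
  measurable_fun setT h -> bm f -> bm (f \o h).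
Proof.
move=> mh [mf [M fM]]; split; first exact: measurableT_comp.
by exists M => w /=.
Qed.

Section Expectation.
Context d (T : measurableType d) (R : realType) (P : probability T R).
Implicit Types f g : T -> R.
Local Notation Ex := (Rintegral P setT).

Lemma bm_integrable f : bm f -> P.-integrable setT (EFin \o f).
Proof.
move=> [mf [M fM]]; apply: measurable_bounded_integrable => //.
  by rewrite ltey_eq fin_num_measure.
exists M; split; first by rewrite num_real.
by move=> x Mx w _; exact: (le_trans (fM w) (ltW Mx)).
Qed.

Lemma Ex_cst (c : R) : Ex (fun=> c) = c.
Proof.
have /(congr1 fine)/= h := probability_setT P.
by rewrite Rintegral_cst// [X in _ * X]h mulr1.
Qed.

Lemma Ex_add f g : bm f -> bm g -> Ex (fun w => f w + g w) = Ex f + Ex g.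
Proof. by move=> bf bg; rewrite RintegralD//; exact: bm_integrable. Qed.

Lemma Ex_sub f g : bm f -> bm g -> Ex (fun w => f w - g w) = Ex f - Ex g.
Proof. by move=> bf bg; rewrite RintegralB//; exact: bm_integrable. Qed.

Lemma Ex_scale (c : R) f : bm f -> Ex (fun w => c * f w) = c * Ex f.
Proof. by move=> bf; rewrite RintegralZl//; exact: bm_integrable. Qed.

Lemma Ex_le f g : bm f -> bm g -> (forall w, f w <= g w) -> Ex f <= Ex g.
Proof. by move=> bf bg fg; apply: le_Rintegral => //; exact: bm_integrable. Qed.

Lemma Ex_sum (I : Type) (r : seq I) (F : I -> T -> R) :
  (forall i, bm (F i)) -> Ex (fun w => \sum_(i <- r) F i w) = \sum_(i <- r) Ex (F i).
Proof.
move=> bF; elim: r => [|i r IH].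
  by rewrite big_nil -[RHS](Ex_cst 0); congr Rintegral; apply/funext => w; rewrite big_nil.
rewrite big_cons -IH -Ex_add//; last exact: bm_sum.
by congr Rintegral; apply/funext => w; rewrite big_cons.
Qed.

Lemma Ex_indic (A : set T) : measurable A -> (Ex \1_A)%:E = P A.
Proof.
move=> mA; rewrite /Rintegral integral_indic// setIT fineK//.
by rewrite fin_num_measure.
Qed.

Lemma EFin_Ex f : bm f -> (Ex f)%:E = (\int[P]_w (f w)%:E)%E.
Proof.
by move=> bf; rewrite /Rintegral fineK//; apply: integrable_fin_num => //; exact: bm_integrable.
Qed.

Lemma Ex_ae_eq f g : bm f -> bm g -> {ae P, forall w, f w = g w} -> Ex f = Ex g.
Proof.
move=> bf bg fg; congr fine; apply: ae_eq_integral => //.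
- by apply/measurable_EFinP; case: bf.
- by apply/measurable_EFinP; case: bg.
- by apply: filterS fg => w -> .
Qed.

Lemma markov_expR f (eta lam : R) : bm f -> 0 <= lam ->
  (P [set w | (eta <= f w)%R] <= (expR (- (lam * eta)) * Ex (fun w => expR (lam * f w)))%:E)%E.
Proof.
move=> bf l0.
have mA : measurable [set w | eta <= f w].
  rewrite -[X in measurable X]setTI; have [mf _] := bf.
  have -> : [set w | eta <= f w] = f @^-1` `[eta, +oo[%classic.
    by apply/seteqP; split => w /=; rewrite in_itv/= andbT.
  exact: mf.
have be : bm (fun w => expR (lam * f w)) by apply: bm_expR; exact: bm_scale.
rewrite -Ex_indic// lee_fin -Ex_scale//; apply: Ex_le; [exact: bm_indic|exact: bm_scale|].
move=> w; rewrite indicE -expRD; case: (boolP (w \in _)) => [|_]; last exact: expR_ge0.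
rewrite inE/= => fw; rewrite -[leLHS]expR0 ler_expR addrC subr_ge0.
by rewrite ler_wpM2l.
Qed.

Lemma borel_cantelli_sq (A : nat -> set T) (C : R) :
  (forall n, measurable (A n)) ->
  (forall n, (P (A n) <= (C * (n.+1%:R ^- 2))%:E)%E) ->
  {ae P, forall w, exists N, forall n, (N <= n)%N -> ~ A n w}.
Proof.
move=> mA PA.
have C0 : 0 <= C.
  have := PA 0%N; rewrite expr1n invr1 mulr1 -lee_fin; apply: le_trans; exact: measure_ge0.
have S : (\sum_(n <oo) P (A n) < +oo)%E.
  apply: (@le_lt_trans _ _ (2 * C)%:E); last exact: ltry.
  apply: lime_le; first exact: is_cvg_nneseries.
  apply: nearW => n.
  apply: (@le_trans _ _ (\sum_(0 <= i < n) (C * (i.+1%:R ^- 2))%:E)%E); first exact: lee_sum.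
  rewrite sumEFin lee_fin -mulr_sumr mulrC ler_wpM2r//.
  case: n => [|n]; first by rewrite big_nil.
  (* Telescoping: [1 / (a + 1)^2 <= 1 / a - 1 / (a + 1)]. *)
  apply: (@le_trans _ _ (2 - (n.+1%:R)^-1)); last by rewrite gerBl.
  elim: n => [|n IH]; first by rewrite big_nat1 expr1n !invr1; lra.
  rewrite big_nat_recr//= (le_trans (lerD IH (lexx _)))//.
  have a0 : 0 < n.+1%:R :> R by rewrite ltr0n.
  rewrite -[n.+2%:R](natr1 n.+1); move: (n.+1%:R) a0 => a a0.
  rewrite -subr_ge0.
  have -> : 2 - (a + 1)^-1 - (2 - a^-1 + (a + 1) ^- 2) = a^-1 * (a + 1) ^- 2.
    by field; rewrite !gt_eqF// ltr_wpDl// ltW.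
  by rewrite mulr_ge0 ?invr_ge0 ?exprn_ge0 ?addr_ge0 ?ltW.
exists (lim_sup_set A); split.
- by apply: bigcapT_measurable => n; apply: bigcup_measurable.
- exact: lim_sup_set_cvg0.
- move=> w /= nw n _; apply: contrapT => h; apply: nw; exists n => m nm Am.
  by apply: h; exists m.
Qed.

End Expectation.

Lemma bigcup_measurable_count dT (T : measurableType dT) (I : countType)
    (D : set I) (F : I -> set T) :
  (forall i, D i -> measurable (F i)) -> measurable (\bigcup_(i in D) F i).
Proof.
move=> mF.
pose G n := if (choice.unpickle n : option I) is Some i
  then [set t | D i /\ F i t] else set0.
have -> : \bigcup_(i in D) F i = \bigcup_n G n.
  apply/seteqP; split => [t [i Di Fit]|t [n _]].
    by exists (choice.pickle i) => //; rewrite /G choice.pickleK.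
  by rewrite /G; case: choice.unpickle => // i [Di Fit]; exists i.
apply: bigcupT_measurable => n; rewrite /G; case: choice.unpickle => // i.
have [Di|nDi] := pselect (D i).
  rewrite (_ : [set t | _] = F i); first exact: mF.
  by apply/seteqP; split => t //= -[].
by rewrite (_ : [set t | _] = set0)//; apply/seteqP; split => t //= -[].
Qed.

(** * Borel sets of row vectors *)

Section BorelRd.
Variables (R : realType) (n : nat).
Local Notation V := 'rV[R]_n.

Lemma rat_dense_rV (x : V) (e : R) : 0 < e ->
  exists q : 'rV[rat]_n, `|x - map_mx ratr q| < e.
Proof.
move=> e0.
have /choice[q qP] : forall j : 'I_n, exists r : rat, `|x 0 j - ratr r| < e.
  move=> j; have [|r] := @rat_in_itvoo R (x 0 j - e) (x 0 j + e); first by lra.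
  rewrite in_itv/= => /andP[h1 h2]; exists r.
  by rewrite ltr_norml; apply/andP; split; lra.
exists (\row_j q j).
suff : ball (map_mx ratr (\row_j q j) : V) e x.
  by rewrite -ball_normE/= distrC.
by split=> // i j; rewrite !mxE -ball_normE/= distrC ord1.
Qed.

Lemma measurable_coord (j : 'I_n) : measurable_fun setT (fun x : Rd R n => (x : V) 0 j).
Proof.
apply: (measurability _ (RGenOpens.measurableE R)) => _ [_ [a [b ->]] <-].
rewrite setTI; apply: sub_sigma_algebra.
have /continuousP : continuous (fun x : V => x 0 j) by exact: coord_continuous.
by apply; exact: interval_open.
Qed.

Lemma continuous_measurable_Rd (f : V -> R) : continuous f ->
  measurable_fun setT (f : Rd R n -> R).
Proof.
move=> /continuousP cf.
apply: (measurability _ (RGenOpens.measurableE R)) => _ [_ [a [b ->]] <-].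
by rewrite setTI; apply: sub_sigma_algebra; apply: cf; exact: interval_open.
Qed.

Lemma bl_bm (f : V -> R) : bl f -> bm (f : Rd R n -> R).
Proof.
move=> bf; split; last by case: bf.
by apply: continuous_measurable_Rd; exact: bl_continuous.
Qed.

Lemma open_rat_balls (O : set V) : open O ->
  O = \bigcup_(c in [set c : 'rV[rat]_n * nat |
        ball (map_mx ratr c.1 : V) c.2.+1%:R^-1 `<=` O])
      ball (map_mx ratr c.1 : V) c.2.+1%:R^-1.
Proof.
move=> oO; apply/seteqP; split => [x Ox|x [c /= cO xc]]; last exact: cO.
have /nbhs_ballP[e /= e0 eO] : nbhs x O by exact: open_nbhs_nbhs.
have [k ke] : exists k, k.+1%:R^-1 < e / 2.
  have e20 : 0 < e / 2 by rewrite divr_gt0.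
  by have [k _ /(_ k (leqnn _))] := near_infty_natSinv_lt (PosNum e20); exists k.
have k0 : 0 < k.+1%:R^-1 :> R by rewrite invr_gt0.
have [q xq] := rat_dense_rV x k0.
have xqb : ball (map_mx ratr q : V) k.+1%:R^-1 x by rewrite -ball_normE/= distrC.
exists (q, k) => //= y; rewrite -ball_normE/= => qy; apply: eO.
rewrite -ball_normE/= (le_lt_trans (ler_distD (map_mx ratr q) _ _))//.
by rewrite [ltRHS]splitr ltrD// (lt_trans _ ke).
Qed.

(** The sigma-algebra of [Rd] is generated by open sets, not by coordinates. Every open set is a
    countable union of balls with rational data, and a ball of the maximum norm is a finite
    intersection of coordinate conditions. *)
Lemma measurable_fun_Rd dT (T : measurableType dT) (f : T -> Rd R n) :
  (forall j, measurable_fun setT (fun t => (f t : V) 0 j)) -> measurable_fun setT f.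
Proof.
move=> mf; have mball (q : V) (e : R) : 0 < e -> measurable (f @^-1` ball q e).
  move=> e0.
  have -> : f @^-1` ball q e = \bigcap_(j in [set: 'I_n])
      ((fun t => (f t : V) 0 j) @^-1` ball (q 0 j) e).
    apply/seteqP; split => [t [_ h] j _|t h]; first exact: h.
    by split => // i j; rewrite ord1; exact: h.
  apply: fin_bigcap_measurable => [|j _]; first exact: finite_finset.
  rewrite -[X in measurable X]setTI.
  by apply: mf => //; apply: open_measurable; exact: ball_open.
apply: (@measurability _ _ T (Rd R n) setT f (@open V : set (set (Rd R n)))) => //.
move=> _ [B oB <-].
rewrite setTI (open_rat_balls oB) preimage_bigcup.
by apply: bigcup_measurable_count => c _; apply: mball; rewrite invr_gt0.
Qed.

End BorelRd.

Section MeasurableRdOps.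
Context (R : realType) (n : nat) dT (T : measurableType dT).
Local Notation V := 'rV[R]_n.
Implicit Types f g : T -> Rd R n.

Lemma measurable_coord_comp f (j : 'I_n) : measurable_fun setT f ->
  measurable_fun setT (fun t => (f t : V) 0 j).
Proof. by move=> mf; apply: (measurableT_comp (measurable_coord j)). Qed.

Lemma measurable_Rd_add f g : measurable_fun setT f -> measurable_fun setT g ->
  measurable_fun setT (fun t => (f t : V) + g t : Rd R n).
Proof.
move=> mf mg; apply: measurable_fun_Rd => j; under eq_fun do rewrite mxE.
by apply: measurable_funD; exact: measurable_coord_comp.
Qed.

Lemma measurable_Rd_scale (r : R) f : measurable_fun setT f ->
  measurable_fun setT (fun t => r *: (f t : V) : Rd R n).
Proof.
move=> mf; apply: measurable_fun_Rd => j; under eq_fun do rewrite mxE.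
by apply: measurable_funM => //; exact: measurable_coord_comp.
Qed.

Lemma measurable_Rd_sum (I : Type) (r : seq I) (F : I -> T -> Rd R n) :
  (forall i, measurable_fun setT (F i)) ->
  measurable_fun setT (fun t => \sum_(i <- r) (F i t : V) : Rd R n).
Proof.
move=> mF; elim: r => [|i r IH].
  by under eq_fun do rewrite big_nil; exact: measurable_cst.
by under eq_fun do rewrite big_cons; exact: measurable_Rd_add.
Qed.

Lemma measurable_fun_countable_arg dS (S : measurableType dS) (u : T -> nat)
    (h : nat -> T -> S) :
  measurable_fun setT u -> (forall k, measurable_fun setT (h k)) ->
  measurable_fun setT (fun t => h (u t) t).
Proof.
move=> mu mh _ B mB; rewrite setTI.
have -> : (fun t => h (u t) t) @^-1` B =
    \bigcup_k (u @^-1` [set k] `&` h k @^-1` B).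
  apply/seteqP; split => [t ht|t [k _ [/= <-]]] //.
  by exists (u t).
apply: bigcupT_measurable => k; apply: measurableI.
  by rewrite -[X in measurable X]setTI; exact: mu.
by rewrite -[X in measurable X]setTI; exact: mh.
Qed.

End MeasurableRdOps.

(** * Independence and Fubini *)

Section Independence.
Context dT (T : measurableType dT) (R : realType) (P : probability T R).
Local Notation Ex := (Rintegral P setT).

(** Dynkin's argument: the events independent of [B] are stable under complements and countable
    disjoint unions. *)
Lemma indep_generated (G : set (set T)) (B : set T) :
  G `<=` measurable -> setI_closed G -> measurable B ->
  (forall A, G A -> P (A `&` B) = (P A * P B)%E) ->
  forall A, <<s G >> A -> P (A `&` B) = (P A * P B)%E.
Proof.
move=> Gm GI mB GB A sA.
have sGm C : <<s G >> C -> measurable C.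
  by apply: smallest_sub => //; exact: sigma_algebra_measurable.
apply: (@dynkin_induction _ (g_sigma_algebraType G) G
  (fun A => P (A `&` B) = (P A * P B)%E)) => //.
- by rewrite setTI probability_setT mul1e.
- move=> S mS PS; have {}mS : measurable (S : set T) by exact: sGm.
  have mSB : @measurable _ T (S `&` B) by exact: (@measurableI _ T).
  have -> : P (~` S `&` B) = (P B - P (B `&` S))%E.
    by rewrite setIC -setDE measureD// ltey_eq fin_num_measure.
  rewrite (setIC B) PS probability_setC// muleBl ?fin_num_measure// ?mul1e//.
- move=> F mF tF PF.
  have mF' k : measurable (F k : set T) by apply: sGm; exact: mF.
  have mFB k : measurable (F k `&` B : set T) by apply: measurableI => //; exact: mF'.
  have tFB : trivIset setT (fun k => F k `&` B).
    apply/trivIsetP => i j _ _ ij; move/trivIsetP : tF => /(_ i j I I ij).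
    by rewrite setIACA setIid => ->; rewrite set0I.
  rewrite setI_bigcupl measure_bigcup// measure_bigcup//.
  rewrite (@eq_eseriesr _ _ (fun k => (fine (P B))%:E * P (F k : set T))%E); last first.
    by move=> k _; rewrite fineK ?fin_num_measure// muleC; exact: PF.
  by rewrite nneseriesZl// fineK ?fin_num_measure// muleC.
Qed.

(** The substitute for conditional expectation: a function of two independent blocks, read on the
    diagonal, integrates as over two independent copies. Turning the sigma-algebras into types lets
    the measurability of [phi] record which block each argument may depend on. *)
Lemma indep_Fubini (G1 G2 : set (set T))
    (phi : g_sigma_algebraType G1 * g_sigma_algebraType G2 -> R) :
  G1 `<=` measurable -> setI_closed G1 -> G2 `<=` measurable -> setI_closed G2 ->
  (forall A B, G1 A -> G2 B -> P (A `&` B) = (P A * P B)%E) -> bm phi ->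
  Ex (fun w => phi (w, w)) = Ex (fun w => Ex (fun w' => phi (w, w'))).
Proof.
move=> G1m G1I G2m G2I G12 bphi.
have s1m C : <<s G1 >> C -> measurable C.
  by apply: smallest_sub => //; exact: sigma_algebra_measurable.
have s2m C : <<s G2 >> C -> measurable C.
  by apply: smallest_sub => //; exact: sigma_algebra_measurable.
have ind A B : <<s G1 >> A -> <<s G2 >> B -> P (A `&` B) = (P A * P B)%E.
  move=> sA sB; apply: (indep_generated G1m) => // [|A' GA']; first exact: s2m.
  rewrite setIC muleC; apply: (indep_generated G2m) => // [|B' GB']; first exact: G1m.
  by rewrite setIC muleC; exact: G12.
have m1 : measurable_fun setT (id : T -> g_sigma_algebraType G1).
  by move=> _ B mB; rewrite setTI; exact: s1m.
have m2 : measurable_fun setT (id : T -> g_sigma_algebraType G2).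
  by move=> _ B mB; rewrite setTI; exact: s2m.
have m12 : measurable_fun setT
    (fun w : T => (w, w) : g_sigma_algebraType G1 * g_sigma_algebraType G2).
  exact: measurable_fun_pair.
pose x1 := isMeasurableFun.Build _ _ _ _ _ m1.
pose X1 : {mfun T >-> g_sigma_algebraType G1} := HB.pack (id : T -> g_sigma_algebraType G1) x1.
pose x2 := isMeasurableFun.Build _ _ _ _ _ m2.
pose X2 : {mfun T >-> g_sigma_algebraType G2} := HB.pack (id : T -> g_sigma_algebraType G2) x2.
pose x12 := isMeasurableFun.Build _ _ _ _ _ m12.
pose X12 : {mfun T >-> (g_sigma_algebraType G1 * g_sigma_algebraType G2)%type} :=
  HB.pack (fun w : T => (w, w) : g_sigma_algebraType G1 * g_sigma_algebraType G2) x12.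
pose Q1 : probability _ R := distribution P X1.
pose Q2 : probability _ R := distribution P X2.
pose Q12 : probability _ R := distribution P X12.
have [mphi [M phiM]] := bphi.
have b1 w : bm (fun w' => phi (w, w')).
  split; last by exists M.
  exact: measurableT_comp (measurable_pair1 w).
have b2 w : bm (fun w' : T => phi (w, w')) by apply: bm_comp m2 (b1 w).
have innerE w : (Ex (fun w' => phi (w, w')))%:E = (\int[Q2]_w' (phi (w, w'))%:E)%E.
  rewrite EFin_Ex; last exact: b2.
  rewrite integral_distribution//; last exact: bm_integrable.
  by apply/measurable_EFinP; case: (b1 w).
have mF : measurable_fun [set: g_sigma_algebraType G1] (fun w => Ex (fun w' => phi (w, w'))).
  apply/measurable_EFinP.
  have : measurable_fun [set: g_sigma_algebraType G1]
    (fun w => \int[Q2]_w' (phi (w, w'))%:E)%E.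
    apply: (@measurable_fubini_F _ _ _ _ _ Q1 Q2 (EFin \o phi)).
    exact: (bm_integrable (Q1 \x Q2)%E).
  by congr measurable_fun; apply/funext => w /=; rewrite innerE.
have bF : bm (fun w : T => Ex (fun w' => phi (w, w'))).
  split; first exact: measurableT_comp mF m1.
  exists M => w; rewrite ler_norml; apply/andP; split.
    rewrite -[leLHS](Ex_cst P); apply: Ex_le => // [|w']; first exact: bm_cst.
    by have := phiM (w, w'); rewrite ler_norml => /andP[].
  rewrite -[leRHS](Ex_cst P); apply: Ex_le => // [|w']; first exact: bm_cst.
  by have := phiM (w, w'); rewrite ler_norml => /andP[].
have bphi12 : bm (fun w : T => phi (w, w)).
  by split; [exact: (measurableT_comp mphi m12)|exists M].
apply: EFin_inj; rewrite !EFin_Ex//.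
transitivity (\int[Q12]_z (phi z)%:E)%E.
  rewrite integral_distribution//; first exact/measurable_EFinP.
  exact: bm_integrable.
(* The law of the diagonal pair factorizes on rectangles by [ind], and rectangles determine it. *)
transitivity (\int[(Q1 \x Q2)%E]_z (phi z)%:E)%E.
  apply: eq_measure_integral => A mA _; apply/esym.
  by apply: (product_measure_unique (m1 := Q1) (m2 := Q2)) => //; exact: ind.
transitivity (\int[Q1]_x \int[Q2]_y (phi (x, y))%:E)%E.
  apply/esym; apply: (@integral12_prod_meas1 _ _ _ _ _ Q1 Q2 (EFin \o phi)).
  exact: bm_integrable.
rewrite integral_distribution//.
- by apply: eq_integral => w _ /=; rewrite innerE.
- apply: (@measurable_fubini_F _ _ _ _ _ Q1 Q2 (EFin \o phi)).
  exact: bm_integrable.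
- have -> : ((fun w => \int[Q2]_w' (phi (w, w'))%:E) \o X1 =
     EFin \o (fun w => Ex (fun w' => phi (w, w'))))%E.
    by apply/funext => w /=; rewrite innerE.
  exact: bm_integrable.
Qed.

End Independence.

Section Cylinders.
Context (T : Type) (I : choiceType).
Implicit Types (E : I -> set (set T)) (J : {fset I}).

(** An intersection-stable family generating the sigma-algebra of the coordinates in [J], as
    Dynkin's argument requires. *)
Definition cyl E J : set (set T) :=
  [set B | exists2 A : I -> set T, (forall j, j \in J -> E j (A j)) &
                                   B = \bigcap_(j in [set` J]) A j].

Lemma cylI E J : (forall j, setI_closed (E j)) -> setI_closed (cyl E J).
Proof.
move=> EI _ _ [A EA ->] [B EB ->]; exists (fun j => A j `&` B j).
  by move=> j jJ; apply: EI; [exact: EA|exact: EB].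
by rewrite bigcapI.
Qed.

Lemma mem_cyl E J j B : (forall i, E i setT) -> j \in J -> E j B -> cyl E J B.
Proof.
move=> ET jJ EB; exists (fun i => if i == j then B else setT).
  by move=> i _; case: eqP => [->|].
apply/seteqP; split => [t Bt i _|t /(_ j jJ)]; last by rewrite eqxx.
by case: eqP.
Qed.

End Cylinders.

Lemma events_ofI dT dV (T : measurableType dT) (V : measurableType dV) (X : T -> V) :
  setI_closed (events_of X).
Proof.
move=> _ _ [A mA <-] [B mB <-]; exists (A `&` B) => //.
exact: measurableI.
Qed.

Lemma events_ofT dT dV (T : measurableType dT) (V : measurableType dV) (X : T -> V) :
  events_of X setT.
Proof. by exists setT => //; exact: measurableT. Qed.

Lemma events_of_measurable dT dV (T : measurableType dT) (V : measurableType dV)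
    (X : T -> V) : measurable_fun setT X -> events_of X `<=` measurable.
Proof. by move=> mX _ [A mA <-]; rewrite -[X in measurable X]setTI; exact: mX. Qed.

Section CylinderIndependence.
Context dT (T : measurableType dT) (I : choiceType).
Implicit Types (E : I -> set (set T)) (J : {fset I}).

Lemma cyl_measurable E J : (forall j, E j `<=` measurable) -> cyl E J `<=` measurable.
Proof.
move=> Em _ [A EA ->]; apply: fin_bigcap_measurable; first exact: finite_fset.
by move=> j jJ; apply: Em; exact: EA.
Qed.

Lemma measurable_fun_cyl E J j dV (V : measurableType dV) (X : T -> V) :
  (forall i, E i setT) -> j \in J -> E j = events_of X ->
  measurable_fun setT (X : g_sigma_algebraType (cyl E J) -> V).
Proof.
move=> ET jJ Ej _ B mB; rewrite setTI; apply: sub_sigma_algebra.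
by apply: mem_cyl jJ _ => //; rewrite Ej; exists B.
Qed.

Lemma cyl_indep (R : realType) (P : probability T R) E J1 J2 A B :
  mutually_independent P E -> [disjoint J1 & J2]%fset ->
  cyl E J1 A -> cyl E J2 B -> P (A `&` B) = (P A * P B)%E.
Proof.
move=> indE /fdisjointP J12 [A' EA ->] [B' EB ->].
(* Since [J1] and [J2] are disjoint, the two families glue into one on the union, to which mutual
   independence applies. *)
pose C j := if j \in J1 then A' j else B' j.
have EC j : j \in (J1 `|` J2)%fset -> E j (C j).
  rewrite in_fsetU /C; case: ifPn => [jJ _|_ /= jJ]; [exact: EA|exact: EB].
rewrite (indE J1 A' EA) (indE J2 B' EB).
have -> : \bigcap_(j in [set` J1]) A' j `&` \bigcap_(j in [set` J2]) B' j =
    \bigcap_(j in [set` (J1 `|` J2)%fset]) C j.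
  apply/seteqP; split => [t [tA tB] j /=|t tC].
    by rewrite in_fsetU /C; case: ifPn => [jJ _|_ /= jJ]; [exact: tA|exact: tB].
  split=> j /= jJ.
    by have := tC j; rewrite /= in_fsetU jJ => /(_ isT); rewrite /C jJ.
  have := tC j; rewrite /= in_fsetU jJ orbT => /(_ isT); rewrite /C.
  by case: ifPn => // /J12; rewrite jJ.
rewrite (indE _ C EC) (perm_big (J1 ++ J2)) /=; last first.
  apply: uniq_perm; first exact: fset_uniq.
    rewrite cat_uniq !fset_uniq andbT/=; apply/hasPn => j jJ; apply/negP => /J12.
    by rewrite jJ.
  by move=> j; rewrite in_fsetU mem_cat.
rewrite big_cat/=; congr (_ * _)%E; apply: eq_big_seq => j jJ; rewrite /C.
  by rewrite jJ.
by case: ifPn => // /J12; rewrite jJ.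
Qed.

End CylinderIndependence.

(** * The walk on the recursive tree *)

Section RecursiveTreeWalk.
Variables (R : realType) (d : nat).
Local Notation V := 'rV[R]_d.
Implicit Types (delta : nat -> V) (u : nat -> nat).

Lemma size_Xseq delta u n : size (Xseq delta u n) = n.
Proof. by elim: n => //= n IH; rewrite size_rcons IH. Qed.

Lemma nth_Xseq delta u n k : (k < n)%N -> nth 0 (Xseq delta u n) k = Xval delta u k.+1.
Proof.
elim: n => // n IH; rewrite ltnS leq_eqVlt => /predU1P[->//|kn].
by rewrite /= nth_rcons size_Xseq kn IH.
Qed.

Lemma XvalS delta u n : (0 < n)%N ->
  Xval delta u n.+1 = nth 0 (Xseq delta u n) (u n.+1).-1 + delta n.+1.
Proof.
case: n => // n _; rewrite /Xval.
have -> : Xseq delta u n.+2 = rcons (Xseq delta u n.+1)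
  (nth 0 (Xseq delta u n.+1) (u n.+2).-1 + delta n.+2) by [].
by rewrite nth_rcons size_Xseq /= ltnn eqxx.
Qed.

(** A position is a sum of distinct steps along an ancestral line, so this holds for every shape of
    the tree; indices out of range read 0. *)
Lemma nth_Xseq_norm delta u n k :
  `|nth 0 (Xseq delta u n) k| <= \sum_(i < n) `|delta i.+1|.
Proof.
elim: n k => [|n IH] k; first by rewrite nth_nil normr0 big_ord0.
rewrite big_ord_recr/= nth_rcons size_Xseq; case: ltngtP => _.
- by rewrite (le_trans (IH _))// lerDl.
- by rewrite normr0 addr_ge0// sumr_ge0.
- case: n IH => [_|n IH]; first by rewrite big_ord0 add0r.
  by rewrite (le_trans (ler_normD _ _))// lerD.
Qed.

Lemma measurable_nth_Xseq dT (T : measurableType dT) (D : nat -> T -> Rd R d)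
    (U : nat -> T -> nat) n k :
  (forall i, (0 < i <= n)%N -> measurable_fun setT (D i)) ->
  (forall i, (1 < i <= n)%N -> measurable_fun setT (U i)) ->
  measurable_fun setT (fun w => nth 0 (Xseq (D^~ w) (U^~ w) n) k : Rd R d).
Proof.
elim: n k => [|n IH] k mD mU.
  by under eq_fun do rewrite nth_nil; exact: measurable_cst.
have {}IH j : measurable_fun setT (fun w => nth 0 (Xseq (D^~ w) (U^~ w) n) j : Rd R d).
  apply: IH => i /andP[i0 ni]; [apply: mD|apply: mU]; by rewrite i0 leqW.
under eq_fun do rewrite /= nth_rcons size_Xseq.
case: ltngtP => _; [exact: IH|exact: measurable_cst|].
case: n mD mU IH => [|n] mD mU IH; first exact: (mD 1%N isT).
apply: measurable_Rd_add; last by apply: mD; rewrite leqnn.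
apply: (measurable_fun_countable_arg (u := U n.+2)
  (h := fun j w => nth 0 (Xseq (D^~ w) (U^~ w) n.+1) j.-1 : Rd R d)) => //.
by apply: mU; rewrite leqnn.
Qed.

Lemma measurable_Xval dT (T : measurableType dT) (D : nat -> T -> Rd R d)
    (U : nat -> T -> nat) n :
  (forall i, (0 < i <= n)%N -> measurable_fun setT (D i)) ->
  (forall i, (1 < i <= n)%N -> measurable_fun setT (U i)) ->
  measurable_fun setT (fun w => Xval (D^~ w) (U^~ w) n : Rd R d).
Proof. exact: measurable_nth_Xseq. Qed.

End RecursiveTreeWalk.

(** * Conditioning on the past of the tree *)

Section Process.
Context (R : realType) (d : nat) dO (Omega : measurableType dO) (P : probability Omega R).
Local Notation V := 'rV[R]_d.
Local Notation Ex := (Rintegral P setT).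
Variables (D : nat -> Omega -> Rd R d) (U : nat -> Omega -> nat).
Variable E : (V -> R) -> R.
Hypothesis E_mean : is_mean E.
Hypothesis mD : forall i, (1 <= i)%N -> measurable_fun setT (D i).
Hypothesis mU : forall n, (2 <= n)%N -> measurable_fun setT (U n).
Hypothesis lawD : forall i (f : V -> R), bl f -> Ex (fun w => f (D i.+1 w)) = E f.
Hypothesis lawU : forall n k, (2 <= n)%N -> (1 <= k <= n.-1)%N ->
  P (U n @^-1` [set k]) = ((n.-1)%:R^-1)%:E.

(** The shifts make both families start at index 0: the steps are numbered from 1, the parents from
    2. *)
Definition coord_events (j : nat + nat) : set (set Omega) :=
  match j with
  | inl i => events_of (D i.+1)
  | inr n => events_of (U n.+2)
  end.

Hypothesis indep : mutually_independent P coord_events.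

Definition X n w : V := Xval (D^~ w) (U^~ w) n.

Let coordT j : coord_events j setT.
Proof. by case: j => j; exact: events_ofT. Qed.

Let coordI j : setI_closed (coord_events j).
Proof. by case: j => j; exact: events_ofI. Qed.

Let coordm j : coord_events j `<=` measurable.
Proof. by case: j => j; apply: events_of_measurable; [exact: mD|exact: mU]. Qed.

(* The indices of the variables that determine [X 1, ..., X n]; [inr i] stands
   for [U i.+2]. *)
Definition past (n : nat) : {fset nat + nat} :=
  [fset j in [seq inl i | i <- iota 0 n] ++ [seq inr i | i <- iota 0 n.-1]]%fset.

Lemma past_inl n i : (inl i \in past n) = (i < n)%N.
Proof.
rewrite !inE; apply/orP/idP => [[/mapP[j + [->]]|/mapP[j _ //]]|ni].
  by rewrite mem_iota.
by left; apply: map_f; rewrite mem_iota.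
Qed.

Lemma past_inr n i : (inr i \in past n) = (i < n.-1)%N.
Proof.
rewrite !inE; apply/orP/idP => [[/mapP[j _ //]|/mapP[j + [->]]]|ni].
  by rewrite mem_iota.
by right; apply: map_f; rewrite mem_iota.
Qed.

Local Notation F J := (g_sigma_algebraType (cyl coord_events J)).

Lemma measurable_D_cyl J i : inl i \in J -> measurable_fun setT (D i.+1 : F J -> Rd R d).
Proof. by move=> iJ; apply: measurable_fun_cyl iJ _. Qed.

Lemma measurable_U_cyl J i : inr i \in J -> measurable_fun setT (U i.+2 : F J -> nat).
Proof. by move=> iJ; apply: measurable_fun_cyl iJ _. Qed.

Lemma measurable_D_past n i : (0 < i <= n)%N ->
  measurable_fun setT (D i : F (past n) -> Rd R d).
Proof. by case: i => // i ni; apply: measurable_D_cyl; rewrite past_inl. Qed.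

Lemma measurable_U_past n i : (1 < i <= n)%N ->
  measurable_fun setT (U i : F (past n) -> nat).
Proof.
by case: i n => // -[//|i] [|n]// ni; apply: measurable_U_cyl; rewrite past_inr.
Qed.

Lemma measurable_X_past n i : (i <= n)%N ->
  measurable_fun setT (X i : F (past n) -> Rd R d).
Proof.
move=> ni; apply: measurable_Xval => j /andP[j0 ji].
  by apply: measurable_D_past; rewrite j0 (leq_trans ji).
by apply: measurable_U_past; rewrite j0 (leq_trans ji).
Qed.

Lemma measurable_X n : measurable_fun setT (X n : Omega -> Rd R d).
Proof.
apply: measurable_Xval => j /andP[j0 _]; [exact: mD|exact: mU].
Qed.

Lemma measurable_forget J : measurable_fun setT (id : Omega -> F J).
Proof.
move=> _ B mB; rewrite setTI; move: B mB.
apply: smallest_sub; first exact: sigma_algebra_measurable.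
exact: (cyl_measurable (E := coord_events) coordm).
Qed.

Lemma bm_forget J (f : F J -> R) : bm f -> bm (f : Omega -> R).
Proof. exact/bm_comp/measurable_forget. Qed.

Lemma indep_cyl_Fubini J1 J2 (phi : F J1 * F J2 -> R) : [disjoint J1 & J2]%fset ->
  bm phi -> Ex (fun w => phi (w, w)) = Ex (fun w => Ex (fun w' => phi (w, w'))).
Proof.
move=> J12; apply: indep_Fubini.
- exact: cyl_measurable.
- exact: cylI.
- exact: cyl_measurable.
- exact: cylI.
- by move=> A B; exact: (cyl_indep indep).
Qed.

(** The [n] prescribed atoms of mass [1 / n] already exhaust the total mass. *)
Lemma U_range n : (0 < n)%N ->
  {ae P, forall w, exists2 i, (i < n)%N & U n.+1 w = i.+1}.
Proof.
move=> n0; pose B i := U n.+1 @^-1` [set i.+1].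
have mB i : measurable (B i).
  by rewrite -[X in measurable X]setTI; apply: mU.
have PB : P (\big[setU/set0]_(i < n) B i) = 1%E.
  rewrite measure_bigsetU//; last first.
    apply/trivIsetP => i j _ _ /eqP ij; apply/seteqP; split => w //= [].
    by rewrite /B/= => -> [/ij].
  rewrite (eq_bigr (fun=> (n%:R^-1)%:E)); last first.
    by move=> i _; exact: (@lawU n.+1 i.+1 n0 (ltn_ord i)).
  by rewrite sumEFin sumr_const card_ord -(mulr_natr n%:R^-1) mulVf// pnatr_eq0 -lt0n.
exists (~` \big[setU/set0]_(i < n) B i); split.
- by apply: measurableC; exact: bigsetU_measurable.
- rewrite probability_setC ?PB ?subee//; exact: bigsetU_measurable.
- move=> w /= nw; rewrite -bigcup_mkord => -[i /= ni Bi]; apply: nw.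
  by exists i.
Qed.

(** One step with the past frozen as a deterministic [y]: Fubini integrates out the new step, and
    the uniform parent is then summed over its values. *)
Lemma Ex_attach (y : nat -> V) (g : V -> R) n : (0 < n)%N -> bl g ->
  Ex (fun w => g (y (U n.+1 w) + D n.+1 w)) = n%:R^-1 * \sum_(i < n) tr E g (y i.+1).
Proof.
move=> n0 bg.
have [M gM] : exists M, forall x, `|g x| <= M by case: bg.
pose JU : {fset nat + nat} := [fset inr n.-1]%fset.
pose JD : {fset nat + nat} := [fset inl n]%fset.
pose phi (z : F JU * F JD) := g (y (U n.+1 z.1) + D n.+1 z.2).
have mUJ : measurable_fun setT (U n.+1 : F JU -> nat).
  by rewrite -(prednK n0); apply: measurable_U_cyl; rewrite in_fset1.
have mDJ : measurable_fun setT (D n.+1 : F JD -> Rd R d).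
  by apply: measurable_D_cyl; rewrite in_fset1.
have bphi : bm phi.
  split; last by exists M => z; exact: gM.
  apply: (measurable_fun_countable_arg (T := (F JU * F JD)%type)
    (u := fun z => U n.+1 z.1) (h := fun k z => g (y k + D n.+1 z.2))).
    exact: (measurableT_comp mUJ measurable_fst).
  move=> k; have [mg _] := bl_bm (bl_shift (y k) bg).
  exact: (measurableT_comp mg (measurableT_comp mDJ measurable_snd)).
rewrite (indep_cyl_Fubini (phi := phi)) => //; last first.
  by apply/fdisjointP => j; rewrite in_fset1 => /eqP ->; rewrite in_fset1.
rewrite /phi/=.
transitivity (Ex (fun w => tr E g (y (U n.+1 w)))).
  congr Rintegral; apply/funext => w.
  exact: (lawD n (bl_shift (y (U n.+1 w)) bg)).
have mUn : measurable_fun setT (U n.+1) by exact: mU.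
have mB i : measurable (U n.+1 @^-1` [set i]).
  by rewrite -[X in measurable X]setTI; apply: mUn.
transitivity (Ex (fun w => \sum_(i < n)
    tr E g (y i.+1) * \1_(U n.+1 @^-1` [set i.+1]) w)).
  apply: Ex_ae_eq.
  - split; last by exists M => w; apply: tr_bounded => //.
    exact: (measurable_fun_countable_arg (h := fun k _ => tr E g (y k)) mUn).
  - by apply: bm_sum => i _; apply: bm_scale; exact: bm_indic.
  - apply: filterS (U_range n0) => w [i ni Ui].
    rewrite (bigD1 (Ordinal ni))//= Ui indicE mem_set// mulr1 big1 ?addr0// => j ji.
    rewrite indicE memNset ?mulr0//= Ui => -[ij]; move/eqP: ji; apply.
    by apply: val_inj.
rewrite Ex_sum; last by move=> i; apply: bm_scale; exact: bm_indic.
rewrite mulr_sumr; apply: eq_bigr => i _; rewrite Ex_scale; last exact: bm_indic.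
rewrite mulrC; congr (_ * _); apply: EFin_inj; rewrite Ex_indic//.
by rewrite lawU//=.
Qed.

(** The conditional mean of [g (X n.+1)] given the past, expressed by testing against an arbitrary
    bounded past-measurable [H]. *)
Lemma Ex_X_step (g : V -> R) n (H : F (past n) -> R) : (0 < n)%N -> bl g -> bm H ->
  Ex (fun w => g (X n.+1 w) * H w) =
  n%:R^-1 * \sum_(i < n) Ex (fun w => tr E g (X i.+1 w) * H w).
Proof.
move=> n0 bg bH.
have [M gM] : exists M, forall x, `|g x| <= M by case: bg.
pose J : {fset nat + nat} := [fset inr n.-1; inl n]%fset.
(* Reading positions with default 0 makes [phi] total, also for parent values outside the range. *)
pose Y k w : V := nth 0 (Xseq (D^~ w) (U^~ w) n) k.-1.
have mY k : measurable_fun setT (Y k : F (past n) -> Rd R d).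
  apply: measurable_nth_Xseq => i; [exact: measurable_D_past|exact: measurable_U_past].
have mUJ : measurable_fun setT (U n.+1 : F J -> nat).
  by rewrite -(prednK n0); apply: measurable_U_cyl; rewrite !inE eqxx.
have mDJ : measurable_fun setT (D n.+1 : F J -> Rd R d).
  by apply: measurable_D_cyl; rewrite !inE eqxx orbT.
pose phi (z : F (past n) * F J) := g (Y (U n.+1 z.2) z.1 + D n.+1 z.2) * H z.1.
have bphi : bm phi.
  apply: bm_mul; last by apply: (bm_comp _ bH); exact: measurable_fst.
  split; last by exists M => z; exact: gM.
  have [mg _] := bl_bm bg.
  apply: (measurable_fun_countable_arg (T := (F (past n) * F J)%type)
    (u := fun z => U n.+1 z.2) (h := fun k z => g (Y k z.1 + D n.+1 z.2))).
    exact: (measurableT_comp mUJ measurable_snd).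
  move=> k; apply: (measurableT_comp mg).
  apply: measurable_Rd_add; first exact: (measurableT_comp (mY k) measurable_fst).
  exact: (measurableT_comp mDJ measurable_snd).
transitivity (Ex (fun w => phi (w, w))).
  by congr Rintegral; apply/funext => w; rewrite /phi/= /X XvalS.
rewrite indep_cyl_Fubini//; last first.
  apply/fdisjointP => -[] j; rewrite ?past_inl ?past_inr !inE => jn.
    by apply/negP => /orP[/eqP//|/eqP[jn']]; rewrite jn' ltnn in jn.
  by apply/negP => /orP[/eqP[jn']|/eqP//]; rewrite jn' ltnn in jn.
rewrite /phi/=.
have bX i : (i < n)%N -> bm (fun w => tr E g (X i.+1 w) * H w).
  move=> ni; apply: bm_mul; last exact: bm_forget.
  by apply: (bm_comp (measurable_X i.+1) (bl_bm (bl_tr E_mean bg))).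
transitivity (Ex (fun w => n%:R^-1 * \sum_(i < n) (tr E g (X i.+1 w) * H w))).
  congr Rintegral; apply/funext => w.
  rewrite -mulr_suml mulrA.
  transitivity (Ex (fun w' => H w * g (Y (U n.+1 w') w + D n.+1 w'))).
    by congr Rintegral; apply/funext => w'; rewrite mulrC.
  rewrite Ex_scale; last first.
    split; last by exists M => w'; exact: gM.
    apply: (measurable_fun_countable_arg (h := fun k w' => g (Y k w + D n.+1 w'))).
      exact: mU.
    move=> k; have [mg _] := bl_bm (bl_shift (Y k w) bg).
    exact: (measurableT_comp mg (mD _)).
  rewrite (Ex_attach (Y^~ w))// mulrC; congr (_ * _ * _).
  by apply: eq_bigr => i _; rewrite /Y /= nth_Xseq.
rewrite Ex_scale; last by apply: bm_sum => i _; exact: bX.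
by congr (_ * _); rewrite Ex_sum// => i; exact: bX.
Qed.

(** Integrating out the last step replaces [f] by [tr E f]; this identifies the iterates of the
    operator at 0 with the law of the sums in the hypothesis. *)
Lemma Ex_sum_steps (f : V -> R) n : bl f ->
  Ex (fun w => f (\sum_(1 <= i < n.+1) (D i w : V))) = trn E n f 0.
Proof.
elim: n f => [|n IH] f bf.
  by under eq_Rintegral do rewrite big_nil; rewrite Ex_cst.
have [M fM] : exists M, forall x, `|f x| <= M by case: bf.
have bt := bl_tr E_mean bf.
rewrite [RHS]/trn iterSr -[RHS]/(trn E n (tr E f) 0) -IH//.
pose J : {fset nat + nat} := [fset inl n]%fset.
have mDJ : measurable_fun setT (D n.+1 : F J -> Rd R d).
  by apply: measurable_D_cyl; rewrite in_fset1.
pose S w : V := \sum_(1 <= i < n.+1) (D i w : V).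
have mS : measurable_fun setT (S : F (past n) -> Rd R d).
  rewrite /S; under eq_fun do rewrite big_add1/= big_mkord.
  apply: measurable_Rd_sum => i; apply: measurable_D_past.
  by rewrite /= ltn_ord.
pose phi (z : F (past n) * F J) := f (S z.1 + D n.+1 z.2).
have bphi : bm phi.
  split; last by exists M => z; exact: fM.
  have [mf _] := bl_bm bf; apply: (measurableT_comp mf).
  apply: measurable_Rd_add; first exact: (measurableT_comp mS measurable_fst).
  exact: (measurableT_comp mDJ measurable_snd).
transitivity (Ex (fun w => phi (w, w))).
  by congr Rintegral; apply/funext => w; rewrite big_nat_recr.
rewrite indep_cyl_Fubini//; last first.
  apply/fdisjointP => -[] j; rewrite ?past_inl ?past_inr !inE => jn; last by [].
  by apply/negP => /eqP[jn']; rewrite jn' ltnn in jn.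
congr Rintegral; apply/funext => w.
exact: (lawD n (bl_shift (S w) bf)).
Qed.

(** Since [(1 - x) * expR x <= 1], it is enough that [1 - x] times the right side is
    [1 + x ^+ 2 * (1 - 2 * x)], which is at least 1. *)
Lemma expR_le_quad (x : R) : x <= 2^-1 -> expR x <= 1 + x + 2 * x ^+ 2.
Proof.
move=> x2; have h0 : 0 < 1 - x by lra.
have h1 := expR_ge1Dx (- x); have h2 := expRxMexpNx_1 x.
have e0 := expR_gt0 x.
have h3 : (1 - x) * expR x <= 1.
  by rewrite -[leRHS]h2 mulrC ler_pM2l.
rewrite -(ler_pM2l h0) (le_trans h3)// -subr_ge0.
have -> : (1 - x) * (1 + x + 2 * x ^+ 2) - 1 = x ^+ 2 * (1 - 2 * x) by ring.
by rewrite mulr_ge0 ?sqr_ge0//; lra.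
Qed.

(** * Azuma's inequality along the tree *)

Section Azuma.
Variables (G : nat -> V -> R) (k n : nat).
Hypothesis k0 : (0 < k)%N.
Hypothesis blG : forall j, bl (G j).
Hypothesis G1 : forall j x, `|G j x| <= 1.
Hypothesis GS : forall j x, (k <= j < n)%N ->
  G j x = (j%:R * G j.+1 x + tr E (G j.+1) x) / j.+1%:R.

(* When [G] solves [GS], this is a martingale from time [k] to time [n]. *)
Definition mart j w : R := j%:R^-1 * \sum_(i < j) G j (X i.+1 w).

Lemma mart_past j m : (j <= m)%N -> bm (mart j : F (past m) -> R).
Proof.
move=> jm; apply: bm_scale; apply: bm_sum => i _.
apply: (bm_comp _ (bl_bm (blG j))); apply: measurable_X_past.
exact: leq_trans (ltn_ord i) jm.
Qed.

Lemma bm_mart j : bm (mart j).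
Proof. exact: bm_forget (mart_past (leqnn j)). Qed.

(** The new vertex, of weight [1 / j.+1], contributes its value minus its conditional mean. *)
Definition mart_incr j w : R := j.+1%:R^-1 *
  (G j.+1 (X j.+1 w) - j%:R^-1 * \sum_(i < j) tr E (G j.+1) (X i.+1 w)).

Lemma martS j w : (k <= j < n)%N -> mart j.+1 w = mart j w + mart_incr j w.
Proof.
move=> kjn; have /andP[kj _] := kjn; have j0 : j%:R != 0 :> R.
  by rewrite pnatr_eq0 -lt0n (leq_trans k0).
rewrite /mart /mart_incr big_ord_recr/=.
under [in RHS]eq_bigr do rewrite GS//.
rewrite -mulr_suml big_split/= -mulr_sumr.
have j1 : j%:R + 1 != 0 :> R by rewrite natr1 pnatr_eq0.
move: (\sum_(i < j) _) (\sum_(i < j) _) (G _ _) => a b c; rewrite -natr1.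
by move: (j%:R : R) j0 j1 => e j0 j1; field; rewrite ?j0 ?j1.
Qed.

Lemma mart_incr_bound j w : (0 < j)%N -> `|mart_incr j w| <= 2 / j.+1%:R.
Proof.
move=> j0; rewrite /mart_incr normrM ger0_norm ?invr_ge0// mulrC.
rewrite ler_wpM2r ?invr_ge0// (le_trans (ler_normB _ _))//.
rewrite [leRHS](_ : 2 = 1 + 1)// lerD//.
rewrite normrM ger0_norm ?invr_ge0// ler_pdivrMl ?ltr0n// mulr1.
rewrite (le_trans (ler_norm_sum _ _ _))//.
apply: (@le_trans _ _ (\sum_(i < j) 1)); last by rewrite sumr_const card_ord.
by apply: ler_sum => i _; apply: tr_bounded.
Qed.

Lemma Ex_mart_incr j (H : F (past j) -> R) : (0 < j)%N -> bm H ->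
  Ex (fun w => mart_incr j w * H w) = 0.
Proof.
move=> j0 bH; have bt i : bm (fun w => tr E (G j.+1) (X i w) * H w).
  apply: bm_mul; last exact: bm_forget.
  by apply: (bm_comp (measurable_X i) (bl_bm (bl_tr E_mean (blG _)))).
have bg i : bm (fun w => G j.+1 (X i w) * H w).
  apply: bm_mul; last exact: bm_forget.
  by apply: (bm_comp (measurable_X i) (bl_bm (blG _))).
transitivity (Ex (fun w => j.+1%:R^-1 * (G j.+1 (X j.+1 w) * H w -
    j%:R^-1 * \sum_(i < j) (tr E (G j.+1) (X i.+1 w) * H w)))).
  by congr Rintegral; apply/funext => w; rewrite /mart_incr -mulr_suml; ring.
have bs : bm (fun w => \sum_(i < j) (tr E (G j.+1) (X i.+1 w) * H w)) by exact: bm_sum.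
rewrite Ex_scale; last by apply: bm_sub => //; exact: bm_scale.
rewrite Ex_sub//; last exact: bm_scale.
by rewrite Ex_scale// Ex_sum// Ex_X_step// subrr mulr0.
Qed.

(** The condition on [lam] keeps [lam] times an increment below 1/2, where [expR_le_quad] applies.
    The linear term has mean zero against the past, and the quadratic one is at most
    [2 * (2 * lam / j.+1) ^+ 2], whose sum over [j] telescopes. *)
Lemma Ex_expR_mart (lam : R) j : `|lam| <= k%:R / 4 -> (k <= j <= n)%N ->
  Ex (fun w => expR (lam * (mart j w - mart k w))) <=
  expR (8 * lam ^+ 2 * (k%:R^-1 - j%:R^-1)).
Proof.
move=> lamk; elim: j => [|j IH] /andP[kj jn].
  by have := leq_trans k0 kj.
move: kj; rewrite leq_eqVlt => /predU1P[->|kj].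
  by rewrite subrr mulr0; under eq_Rintegral do rewrite subrr mulr0; rewrite expR0 Ex_cst.
have {}IH := IH (introT andP (conj kj (ltnW jn))).
have kjn : (k <= j < n)%N by rewrite -ltnS kj.
have j0 : (0 < j)%N by apply: (leq_trans k0); rewrite -ltnS.
pose W w := expR (lam * (mart j w - mart k w)).
have bWp : bm (W : F (past j) -> R).
  by apply: bm_expR; apply: bm_scale; apply: bm_sub; exact: mart_past.
have bW := bm_forget bWp.
have binc : bm (mart_incr j).
  have -> : mart_incr j = (fun w => mart j.+1 w - mart j w).
    by apply/funext => w; rewrite martS// addrC addKr.
  by apply: bm_sub; exact: bm_mart.
have j1 : 0 < j.+1%:R :> R by rewrite ltr0n.
pose c := 8 * lam ^+ 2 / j.+1%:R ^+ 2.
have step w : expR (lam * (mart j.+1 w - mart k w)) <=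
    (1 + c) * W w + lam * (mart_incr j w * W w).
  rewrite martS// [_ + _ - _]addrAC mulrDr expRD -/(W w).
  have inc := mart_incr_bound w j0.
  have linc : `|lam * mart_incr j w| <= 2^-1.
    rewrite normrM (le_trans (ler_pM _ _ lamk inc))//.
    have -> : k%:R / 4 * (2 / j.+1%:R) = 2^-1 * (k%:R / j.+1%:R) :> R.
      by move: (j.+1%:R^-1) => z; field.
    by rewrite ler_piMr// ler_pdivrMr// mul1r ler_nat ltnW.
  have q := expR_le_quad (le_trans (ler_norm _) linc).
  have sq : 2 * (lam * mart_incr j w) ^+ 2 <= c.
    rewrite /c exprMn.
    have : mart_incr j w ^+ 2 <= (2 / j.+1%:R) ^+ 2.
      by rewrite -[leLHS]real_normK ?num_real// lerXn2r// nnegrE ?divr_ge0.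
    have e2 : (2 / j.+1%:R) ^+ 2 = 4 * j.+1%:R ^- 2 :> R.
      by rewrite -exprVn; move: (j.+1%:R^-1) => z; ring.
    move=> /(ler_wpM2l (sqr_ge0 lam)); rewrite e2.
    move: (j.+1%:R ^- 2) (mart_incr j w ^+ 2) (lam ^+ 2) => a b e; lra.
  have W0 : 0 <= W w by exact: expR_ge0.
  have {}q : expR (lam * mart_incr j w) <= 1 + lam * mart_incr j w + c by lra.
  have := ler_wpM2l W0 q; move: (W w) (mart_incr j w) (expR _) => a b e; lra.
apply: (@le_trans _ _ (Ex (fun w => (1 + c) * W w + lam * (mart_incr j w * W w)))).
  apply: Ex_le => //.
    by apply: bm_expR; apply: bm_scale; apply: bm_sub; exact: bm_mart.
  by apply: bm_add; apply: bm_scale => //; exact: bm_mul.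
rewrite Ex_add; [|exact: bm_scale|by apply: bm_scale; exact: bm_mul].
rewrite !Ex_scale//; last exact: bm_mul.
rewrite Ex_mart_incr// mulr0 addr0.
apply: (@le_trans _ _ (expR c * expR (8 * lam ^+ 2 * (k%:R^-1 - j%:R^-1)))).
  apply: ler_pM => //; last exact: expR_ge1Dx.
    by rewrite addr_ge0// /c mulr_ge0 ?invr_ge0 ?exprn_ge0// mulr_ge0// sqr_ge0.
  by apply: Rintegral_ge0 => w _; exact: expR_ge0.
have l0 : 0 <= 8 * lam ^+ 2 by apply: mulr_ge0 => //; exact: sqr_ge0.
rewrite -expRD ler_expR /c -mulrDr ler_wpM2l//.
have j0' : 0 < j%:R :> R by rewrite ltr0n.
suff : j.+1%:R ^- 2 <= j%:R^-1 - j.+1%:R^-1 :> R.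
  by move: (j.+1%:R ^- 2) (j%:R^-1) (j.+1%:R^-1) (k%:R^-1) => a b e a' h; lra.
rewrite -natr1; move: (j%:R : R) j0' => a a0.
rewrite -subr_ge0; have -> : a^-1 - (a + 1)^-1 - (a + 1) ^- 2 = a^-1 * (a + 1) ^- 2.
  by field; rewrite !gt_eqF// ltr_wpDl// ltW.
by rewrite mulr_ge0 ?invr_ge0 ?exprn_ge0 ?addr_ge0 ?ltW.
Qed.

Lemma azuma (eta : R) : 0 < eta <= 1 -> (k <= n)%N ->
  (P [set w | (eta <= `|mart n w - mart k w|)%R] <=
   (2 * expR (- (eta ^+ 2 / 32 * k%:R)))%:E)%E.
Proof.
move=> /andP[eta0 eta1] kn.
have k0' : 0 < k%:R :> R by rewrite ltr0n.
(* The minimizer of [- lam * eta + 8 * lam ^+ 2 / k], with value [- eta ^+ 2 * k / 32]; [eta <= 1]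
   makes it admissible. *)
pose lam := eta * k%:R / 16.
have lam0 : 0 <= lam by rewrite !mulr_ge0// ltW.
have lamk : lam <= k%:R / 4.
  by rewrite /lam; have := ler_wpM2r (ltW k0') eta1; rewrite mul1r; lra.
have tail (s : R) : `|s| = 1 ->
    (P [set w | (eta <= s * (mart n w - mart k w))%R] <=
     (expR (- (eta ^+ 2 / 32 * k%:R)))%:E)%E.
  move=> s1; have bM : bm (fun w => s * (mart n w - mart k w)).
    by apply: bm_scale; apply: bm_sub; exact: bm_mart.
  apply: (le_trans (markov_expR P eta bM lam0)); rewrite lee_fin.
  have slam : `|lam * s| <= k%:R / 4 by rewrite normrM s1 mulr1 ger0_norm.
  have := @Ex_expR_mart (lam * s) n slam (introT andP (conj kn (leqnn n))).
  under eq_Rintegral do rewrite -mulrA.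
  move=> /(ler_wpM2l (expR_ge0 (- (lam * eta)))) /le_trans; apply.
  rewrite -expRD ler_expR exprMn -(@real_normK _ s) ?num_real// s1 expr1n mulr1.
  have n0 : 0 <= n%:R^-1 :> R by rewrite invr_ge0.
  have := mulr_ge0 (mulr_ge0 (ler0n R 8) (sqr_ge0 lam)) n0.
  rewrite mulrBr => h; apply: (@le_trans _ _ (- (lam * eta) + 8 * lam ^+ 2 / k%:R)).
    by move: h; move: (8 * lam ^+ 2) => a; lra.
  rewrite /lam [leLHS](_ : _ = - (eta ^+ 2 / 32 * k%:R))//.
  by field; rewrite gt_eqF.
have mart_meas s : measurable [set w | (eta <= s * (mart n w - mart k w))%R].
  have [mf _] : bm (fun w => s * (mart n w - mart k w)).
    by apply: bm_scale; apply: bm_sub; exact: bm_mart.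
  rewrite -[X in measurable X]setTI.
  have -> : [set w | eta <= s * (mart n w - mart k w)] =
      (fun w => s * (mart n w - mart k w)) @^-1` `[eta, +oo[%classic.
    by apply/seteqP; split => w /=; rewrite in_itv/= andbT.
  exact: mf.
have -> : [set w | eta <= `|mart n w - mart k w|] =
    [set w | eta <= 1 * (mart n w - mart k w)] `|`
    [set w | eta <= -1 * (mart n w - mart k w)].
  apply/seteqP; split => w /=; rewrite mul1r mulN1r ler_normr.
    by case/orP; [left|right].
  by case=> ->; rewrite ?orbT.
apply: (le_trans (measureU2 _ (mart_meas 1) (mart_meas (-1)))).
rewrite mulr_natl mulr2n EFinD; apply: leeD; apply: tail.
  by rewrite normr1.
by rewrite normrN1.
Qed.

End Azuma.
End Process.

(** * Limits along the logarithmic scale *)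

Section Limits.
Variable R : realType.
Implicit Types (u v : nat -> R) (l : R).

Definition tends u l :=
  forall e, 0 < e -> exists N, forall n, (N <= n)%N -> `|u n - l| <= e.

Lemma tends_cvg u l : tends u l -> u n @[n --> \oo] --> l.
Proof.
move=> ul; apply/cvgrPdist_le => e e0; have [N uN] := ul e e0.
by exists N => // n Nn; rewrite distrC; exact: uN.
Qed.

Lemma cvg_tends u l : u n @[n --> \oo] --> l -> tends u l.
Proof.
move=> /cvgrPdist_le ul e /ul[N _ uN].
by exists N => n Nn; rewrite distrC; exact: uN.
Qed.

Definition lnn (n : nat) : R := ln n%:R.

Lemma lnn_large (M : R) : exists N, forall n, (N <= n)%N -> M <= lnn n.
Proof.
exists (Num.truncn (expR M)).+1 => n Nn.
have := truncn_itv (expR_ge0 M) => /andP[_ h].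
have n0 : 0 < n%:R :> R by rewrite ltr0n; case: n Nn.
rewrite -ler_expR lnK ?posrE//; apply: (le_trans (ltW h)).
by rewrite ler_nat.
Qed.

Lemma expR_lnn n : (0 < n)%N -> expR (lnn n) = n%:R.
Proof. by move=> n0; rewrite lnK// posrE ltr0n. Qed.

(* The time from which the martingale is started: large enough for Azuma's bound
   to be summable, small enough for [ln (start n)] to be negligible before [ln n]. *)
Definition start (n : nat) : nat := Num.truncn (lnn n ^+ 2).

Lemma start_le n : (start n)%:R <= lnn n ^+ 2.
Proof. by rewrite truncn_le sqr_ge0. Qed.

Lemma start_gt n : lnn n ^+ 2 < (start n)%:R + 1.
Proof. by have /andP[_] := truncn_itv (sqr_ge0 (lnn n)); rewrite natr1. Qed.

Lemma start_large N0 : exists N, forall n, (N <= n)%N -> (N0 <= start n)%N.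
Proof.
have [N NP] := lnn_large (N0%:R + 1); exists N => n /NP h.
rewrite truncn_ge_nat ?sqr_ge0//; have N00 : 0 <= N0%:R :> R by [].
apply: (@le_trans _ _ (lnn n)); first by lra.
by rewrite expr2 ler_peMl; lra.
Qed.

(** The tangent to [ln] at [t]; a large [t] makes the slope as small as desired. *)
Lemma ln_le_scaled (t x : R) : 0 < t -> 0 < x -> ln x <= x / t - 1 + ln t.
Proof.
move=> t0 x0; have := ln_le_sub1 (divr_gt0 x0 t0).
by rewrite ln_div ?posrE//; lra.
Qed.

Lemma lnn_sq_le : exists N, forall n, (N <= n)%N -> lnn n ^+ 2 <= n%:R.
Proof.
have [N NP] := lnn_large 1; exists (maxn N 1) => n; rewrite geq_max => /andP[/NP L1 n0].
rewrite -(expR_lnn n0); have L0 : 0 < lnn n by lra.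
have t2 : 0 < 2 :> R by [].
have h := ln_le_scaled t2 L0; have l2 := ln_le_sub1 t2.
rewrite -{1}(lnK L0) -expRM_natr ler_expR -mulr_natr; lra.
Qed.

Lemma start_le_id : exists N, forall n, (N <= n)%N -> (start n <= n)%N.
Proof.
have [N NP] := lnn_sq_le; exists N => n /NP h.
by rewrite -(ler_nat R) (le_trans (start_le n)).
Qed.

(** Completing the square, [c L^2 >= 2 L - 1 / c] with [L = lnn n], so the exponential is at most a
    constant times [n^-2]. The constant [c] in [c + c^-1] pays for the truncation in [start], the
    factor 4 for passing from [n] to [n.+1]. *)
Lemma expR_start_le (c : R) : 0 < c -> exists C, 0 <= C /\ forall n, (0 < n)%N ->
  expR (- (c * (start n)%:R)) <= C * n.+1%:R ^- 2.
Proof.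
move=> c0; exists (expR (c + c^-1) * 4); split; first by rewrite mulr_ge0// expR_ge0.
move=> n n0; have n0' : 0 < n%:R :> R by rewrite ltr0n.
apply: (@le_trans _ _ (expR (c + c^-1) * n%:R ^- 2)).
  rewrite -(expR_lnn n0) -expRM_natr -expRN -expRD ler_expR.
  have := start_gt n; set k := (start n)%:R => hk.
  have h : 0 <= c * (lnn n - c^-1) ^+ 2 by rewrite mulr_ge0 ?sqr_ge0// ltW.
  have e : c * (lnn n - c^-1) ^+ 2 = c * lnn n ^+ 2 - 2 * lnn n + c^-1.
    by field; rewrite gt_eqF.
  have := ltr_pM2l c0 (lnn n ^+ 2) (k + 1); rewrite hk => /idP; rewrite mulrDr mulr1.
  rewrite -mulr_natr; move: h; rewrite e; lra.
have -> : 4 = 2 ^+ 2 :> R by ring.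
rewrite -mulrA ler_wpM2l ?expR_ge0// -exprVn -[X in _ <= _ * X]exprVn -exprMn.
rewrite lerXn2r ?nnegrE ?mulr_ge0 ?invr_ge0//.
rewrite ler_pdivlMr ?ltr0n// ler_pdivrMl// -natrM ler_nat mulnC.
by rewrite mul2n -addnn -addn1 leq_add2l.
Qed.

Lemma poly_start_expR (p : nat) (c A : R) : 0 < c ->
  tends (fun n => A * (start n).+1%:R ^+ p * expR (- (c * lnn n))) 0.
Proof.
move=> c0 e e0.
have p0 : 0 < p%:R + 1 :> R by rewrite ltr_wpDl.
(* With this tangent point the power of [start n] costs at most [expR (B + c / 2 * lnn n)], leaving
   half of the decay. *)
pose t : R := 4 * (p%:R + 1) / c.
have t0 : 0 < t by rewrite divr_gt0// mulr_gt0.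
pose B := p%:R * (ln 2 + 2 * ln t).
have [N1 NP1] := lnn_large 1.
have [N2 NP2] := lnn_large (2 / c * (B + ln ((`|A| + 1) / e))).
exists (maxn N1 N2) => n; rewrite geq_max => /andP[/NP1 L1 /NP2 L2].
have L0 : 0 < lnn n by lra.
have A0 : 0 < `|A| + 1 by rewrite ltr_wpDl.
rewrite subr0 !normrM (@ger0_norm _ (expR _)) ?expR_ge0// (@ger0_norm _ (_ ^+ p)) ?exprn_ge0//.
have k1 : (start n).+1%:R <= expR (ln 2 + 2 * ln (lnn n)).
  have -> : expR (ln 2 + 2 * ln (lnn n)) = 2 * lnn n ^+ 2.
    by rewrite expRD lnK ?posrE// (mulrC 2 (ln _)) expRM_natr lnK.
  have := start_le n; rewrite -natr1; have : 1 <= lnn n ^+ 2 by rewrite expr_ge1//; lra.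
  lra.
have ln2 : 0 <= ln 2 :> R by rewrite ln_ge0//; lra.
have kp : (start n).+1%:R ^+ p <= expR (B + c / 2 * lnn n).
  apply: (@le_trans _ _ (expR (ln 2 + 2 * ln (lnn n)) ^+ p)).
    by rewrite lerXn2r// nnegrE// expR_ge0.
  rewrite -expRM_natr ler_expR mulrC.
  have l1 := ln_le_scaled t0 L0.
  have -> : c / 2 * lnn n = (p%:R + 1) * (2 * (lnn n / t)).
    by rewrite /t; field; rewrite !gt_eqF.
  have pp : 0 <= p%:R :> R by [].
  have := ler_wpM2l pp (lerD (lexx (ln 2)) (ler_wpM2l (ler0n R 2) l1)).
  have : 0 <= lnn n / t by rewrite divr_ge0// ltW.
  rewrite /B; move: (lnn n / t) (ln (lnn n)) => a b; lra.
apply: (@le_trans _ _ ((`|A| + 1) * expR (B + c / 2 * lnn n) * expR (- (c * lnn n)))).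
  rewrite ler_wpM2r ?expR_ge0// ler_pM ?exprn_ge0//; lra.
rewrite -mulrA -expRD -ler_pdivlMl// [leRHS](_ : _ = expR (- ln ((`|A| + 1) / e))); last first.
  by rewrite expRN lnK ?posrE ?divr_gt0// invf_div mulrC.
rewrite ler_expR.
have : 0 < c / 2 by rewrite divr_gt0.
move=> /ltW /ler_wpM2l /(_ _ _ L2).
have -> : c / 2 * (2 / c * (B + ln ((`|A| + 1) / e))) = B + ln ((`|A| + 1) / e).
  by field; rewrite gt_eqF.
lra.
Qed.

Lemma hsum_ge0 k m : 0 <= hsum R k m.
Proof. by elim: m k => //= m IH k; rewrite addr_ge0// invr_ge0. Qed.

(** The bias is at most [1 + ln (start n)], hence of order the square root of [lnn n], and the
    variance is of order [lnn n]; both are negligible before [(lnn n) ^+ 2]. *)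
Lemma hsum_concentration (tau : R) : 0 < tau -> tends (fun n =>
  2 / (tau * lnn n) ^+ 2 * ((hsum R (start n) (n - start n) - lnn n) ^+ 2 +
                            hsum R (start n) (n - start n))) 0.
Proof.
move=> tau0 e e0.
have [N1 NP1] := lnn_large 1; have [N2 NP2] := start_large 1; have [N3 NP3] := start_le_id.
have [N4 NP4] := lnn_large (62 / tau ^+ 2 / e).
exists (maxn (maxn N1 N2) (maxn N3 N4)) => n.
rewrite !geq_max => /andP[/andP[/NP1 L1 /NP2 k0] /andP[/NP3 kn /NP4 L4]].
have L0 : 0 < lnn n by lra.
have := @hsum_ln_dist R (start n) n; rewrite k0 kn => /(_ isT); rewrite -/(lnn n).
set h := hsum R _ _ => hd.
have ss : Num.sqrt (lnn n) ^+ 2 = lnn n by rewrite sqr_sqrtr// ltW.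
(* [lnn n ^+ 2] is the fourth power of the square root of [lnn n], and [ln s <= s]. *)
have lk : ln (start n)%:R <= 4 * Num.sqrt (lnn n).
  have s0 : 0 < Num.sqrt (lnn n) by rewrite sqrtr_gt0.
  have hs := ln_le_sub1 s0.
  apply: (@le_trans _ _ (ln (Num.sqrt (lnn n) ^+ 4))).
    rewrite ler_ln ?posrE ?ltr0n ?exprn_gt0//.
    by rewrite (exprM _ 2 2) ss start_le.
  by rewrite lnXn// -mulr_natr; lra.
have s1 : 1 <= Num.sqrt (lnn n) :> R by rewrite -[leLHS]sqrtr1 ler_wsqrtr.
have hd' : `|h - lnn n| <= 5 * Num.sqrt (lnn n) by lra.
have h2 : (h - lnn n) ^+ 2 <= 25 * lnn n.
  apply: (@le_trans _ _ ((5 * Num.sqrt (lnn n)) ^+ 2)); last by rewrite exprMn ss; lra.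
  rewrite -[leLHS]real_normK ?num_real//.
  by rewrite lerXn2r// nnegrE// mulr_ge0// sqrtr_ge0.
have h3 : h <= 6 * lnn n.
  have : Num.sqrt (lnn n) <= lnn n by rewrite -{2}ss expr2 ler_peMl; lra.
  by move: hd'; rewrite ler_norml => /andP[_]; lra.
have h0 : 0 <= h by exact: hsum_ge0.
have tL : 0 < (tau * lnn n) ^+ 2 by rewrite exprn_gt0// mulr_gt0.
rewrite subr0 ger0_norm; last by rewrite mulr_ge0 ?divr_ge0 ?addr_ge0 ?sqr_ge0// ltW.
apply: (@le_trans _ _ (2 / (tau * lnn n) ^+ 2 * (31 * lnn n))).
  by rewrite ler_wpM2l; [|rewrite divr_ge0// ltW|lra].
have -> : 2 / (tau * lnn n) ^+ 2 * (31 * lnn n) = 62 / tau ^+ 2 / lnn n.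
  by field; rewrite !gt_eqF.
by rewrite ler_pdivrMr// -ler_pdivrMl// mulrC.
Qed.

End Limits.
Arguments lnn : clear implicits.

Section MixtureLimit.
Variables (R : realType) (d : nat).
Local Notation V := 'rV[R]_d.
Variable E : (V -> R) -> R.
Hypothesis E_mean : is_mean E.

(** Only step counts close to [lnn n] have to be examined: for the others the trivial bound 2 is
    dominated by the parabola of [mixop_concentration]. *)
Lemma mixtr_tends (F : nat -> V -> R) (c : R) :
  (forall n, bl (F n)) -> (forall n x, `|F n x| <= 1) -> `|c| <= 1 ->
  (forall eta, 0 < eta -> exists tau N, 0 < tau /\ forall n e, (N <= n)%N ->
     `|e%:R - lnn R n| <= tau * lnn R n -> `|trn E e (F n) 0 - c| <= eta) ->
  tends (fun n => mixtr E (start R n) (n - start R n) (F n) 0) c.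
Proof.
move=> blF F1 c1 H eta eta0.
have eta20 : 0 < eta / 2 by rewrite divr_gt0.
have [tau [N1 [tau0 HN]]] := H _ eta20.
have [N2 HN2] := hsum_concentration tau0 eta20.
have [N3 HN3] := lnn_large (1 : R).
exists (maxn N1 (maxn N2 N3)) => n; rewrite !geq_max => /andP[n1 /andP[/HN2 n2 /HN3 n3]].
have L0 : 0 < lnn R n by lra.
have tL : 0 < (tau * lnn R n) ^+ 2 by rewrite exprn_gt0// mulr_gt0.
have B0 : 0 <= 2 / (tau * lnn R n) ^+ 2 by rewrite divr_ge0// ltW.
apply: (le_trans (mixop_concentration (start R n) (n - start R n) (eta := eta / 2)
   (B := 2 / (tau * lnn R n) ^+ 2) (mu := lnn R n) _ B0)).
  move=> e; have [near|far] := leP `|e%:R - lnn R n| (tau * lnn R n).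
    by rewrite (le_trans (HN _ _ n1 near))// lerDl mulr_ge0// sqr_ge0.
  apply: (@le_trans _ _ 2).
    rewrite (le_trans (ler_normB _ _))// [leRHS](_ : 2 = 1 + 1)// lerD//.
    exact: trn_bounded.
  rewrite -[leLHS]add0r lerD//; first exact: ltW.
  rewrite mulrAC ler_pdivlMr// ler_pM2l// -[leRHS]real_normK ?num_real//.
  by rewrite lerXn2r ?nnegrE ?mulr_ge0// ltW.
by move: n2; rewrite subr0 => /ler_normlW; lra.
Qed.

End MixtureLimit.

Section BoundedConvergence.
Context (R : realType) dT (T : measurableType dT) (P : probability T R).

Lemma bounded_convergence (g : nat -> T -> R) (f : T -> R) (M : R) :
  (forall n, measurable_fun setT (g n)) -> measurable_fun setT f ->
  (forall n w, `|g n w| <= M) -> (forall w, tends (g ^~ w) (f w)) ->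
  tends (fun n => Rintegral P setT (g n)) (Rintegral P setT f).
Proof.
move=> mg mf gM gf; apply: cvg_tends.
have mgE n : measurable_fun setT (EFin \o g n) by exact/measurable_EFinP.
have mfE : measurable_fun setT (EFin \o f) by exact/measurable_EFinP.
have cv : {ae P, forall w, setT w -> (fun n => (EFin \o g n) w) @ \oo --> (EFin \o f) w}.
  apply: aeW => w _; apply: cvg_EFin; first exact: nearW.
  exact: (tends_cvg (gf w)).
have iM : P.-integrable setT (cst M%:E : T -> \bar R).
  exact: (bm_integrable P (bm_cst T M)).
have le : {ae P, forall w n, setT w -> (`|(EFin \o g n) w| <= (cst M%:E : T -> \bar R) w)%E}.
  by apply: aeW => w n _; rewrite lee_fin.
have [fi _] := dominated_convergence measurableT mgE mfE cv iM le.
have <- : ((Rintegral P setT f)%:E = \int[P]_w (EFin \o f) w)%E.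
  by rewrite fineK//; exact: integrable_fin_num.
exact: fine_cvg.
Qed.

(** Tightness of a single random vector, by bounded convergence as the scale grows. *)
Lemma Ex_cap_small d (Y : T -> Rd R d) (eta : R) : measurable_fun setT Y -> 0 < eta ->
  exists rho : R, 0 < rho /\
    Rintegral P setT (fun w => cap (rho *: (Y w : 'rV[R]_d))) <= eta.
Proof.
move=> mY eta0.
have bY (r : R) : bm (fun w => cap (r *: (Y w : 'rV[R]_d))).
  exact: (bm_comp mY (bl_bm (bl_dilate r (bl_cap R d)))).
have : tends (fun n => Rintegral P setT (fun w => cap (n.+1%:R^-1 *: (Y w : 'rV[R]_d))))
    (Rintegral P setT (fun=> 0)).
  apply: (@bounded_convergence _ _ 1) => [n||n w|w e e0].
  - by case: (bY n.+1%:R^-1).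
  - exact: measurable_cst.
  - by rewrite ger0_norm ?cap_ge0 ?cap_le1.
  exists (Num.truncn (`|Y w : 'rV[R]_d| / e)).+1 => n Nn.
  rewrite subr0 ger0_norm ?cap_ge0// (le_trans (cap_le_norm _))// normrZ.
  rewrite ger0_norm ?invr_ge0// ler_pdivrMl// -ler_pdivrMr//.
  have : 0 <= `|Y w : 'rV[R]_d| / e by rewrite divr_ge0// ltW.
  move=> /truncn_itv/andP[_ h]; apply: (le_trans (ltW h)).
  by rewrite ler_nat; exact: leqW.
rewrite Ex_cst => /(_ _ eta0)[N /(_ N (leqnn N))]; rewrite subr0 => /ler_normlW hN.
by exists N.+1%:R^-1; split => //; rewrite invr_gt0.
Qed.

End BoundedConvergence.

Section PowR.
Variable R : realType.

Lemma powR_near1 (alpha delta : R) : 0 < delta ->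
  exists2 tau, 0 < tau & forall x, `|x - 1| <= tau -> `|x `^ alpha - 1| <= delta.
Proof.
move=> delta0.
have [/derivable1_diffP/differentiable_continuous ct _] :=
  is_derive1_powR alpha (ltr01 : 0 < 1 :> R).
move/cvgrPdist_le : ct => /(_ _ delta0)/nbhs_ballP[tau /= tau0 H].
exists (tau / 2); first by rewrite divr_gt0.
move=> x xt; have h := H x; rewrite powR1 in h; rewrite distrC; apply: h.
by rewrite -ball_normE/= distrC; lra.
Qed.

Lemma powRE (x a : R) : 0 < x -> x `^ a = expR (a * ln x).
Proof. by move=> x0; rewrite /powR gt_eqF. Qed.

End PowR.

Section Dilation.
Variables (R : realType) (d : nat).
Local Notation V := 'rV[R]_d.

(** A dilation moves [x] by [|rho - 1| * |x|], which is small uniformly only on bounded sets; the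
    support condition confines the comparison to [|x| < 2 * rad], because [|rho| >= 1/2]. *)
Lemma dilate_near1 (f : V -> R) (rad eta : R) : bl f -> 0 < rad -> 0 < eta ->
  (forall x, rad <= `|x| -> f x = 0) ->
  exists2 delta, 0 < delta & forall rho x, `|rho - 1| <= delta -> `|f (rho *: x) - f x| <= eta.
Proof.
move=> [_ [C fC]] rad0 eta0 f0.
have C0 : 0 < `|C| + 1 by rewrite ltr_wpDl.
have c0 : 0 < (`|C| + 1) * (2 * rad) by rewrite !mulr_gt0.
exists (Num.min 2^-1 (eta / ((`|C| + 1) * (2 * rad)))).
  by rewrite lt_min invr_gt0 ltr0n/= divr_gt0.
move=> rho x; rewrite le_min => /andP[r1 r2].
have [xr|xr] := leP (2 * rad) `|x|.
  rewrite (f0 x); last by lra.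
  rewrite (f0 (rho *: x)) ?subrr ?normr0 ?(ltW eta0)//.
  rewrite normrZ; have : 2^-1 <= `|rho|.
    by have := ler_norm rho; move: r1; rewrite ler_norml => /andP[]; lra.
  move=> h; have := ler_wpM2r (normr_ge0 x) h; lra.
apply: (le_trans (fC _ _)); rewrite -{2}[x]scale1r -scalerBl normrZ.
apply: (@le_trans _ _ ((`|C| + 1) * (`|rho - 1| * `|x|))).
  by rewrite ler_wpM2r ?mulr_ge0// (le_trans (ler_norm C))// lerDl.
move: r2; rewrite ler_pdivlMr// mulrCA => r2; apply: le_trans r2.
by apply: ler_wpM2l; [exact: ltW|apply: ler_wpM2l => //; exact: ltW].
Qed.

End Dilation.

(** * Almost sure limits of the empirical means *)

Section ScalingLimit.
Context (R : realType) (d : nat) dO (Omega : measurableType dO) (P : probability Omega R).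
Local Notation V := 'rV[R]_d.
Local Notation Ex := (Rintegral P setT).
Variables (D : nat -> Omega -> Rd R d) (U : nat -> Omega -> nat).
Variable E : (V -> R) -> R.
Hypothesis E_mean : is_mean E.
Hypothesis mD : forall i, (1 <= i)%N -> measurable_fun setT (D i).
Hypothesis mU : forall n, (2 <= n)%N -> measurable_fun setT (U n).
Hypothesis lawD : forall i (f : V -> R), bl f -> Ex (fun w => f (D i.+1 w)) = E f.
Hypothesis lawU : forall n k, (2 <= n)%N -> (1 <= k <= n.-1)%N ->
  P (U n @^-1` [set k]) = ((n.-1)%:R^-1)%:E.
Hypothesis indep : mutually_independent P (coord_events D U).

Local Notation X := (X D U).
Local Notation avg n g w := (n%:R^-1 * \sum_(i < n) g (X i.+1 w)).

Lemma avg_bound n (g : V -> R) (M : R) w : 0 <= M ->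
  (forall i, (i < n)%N -> g (X i.+1 w) <= M) ->
  avg n g w <= M.
Proof.
move=> M0 gM; case: n gM => [|n] gM; first by rewrite big_ord0 mulr0.
rewrite ler_pdivrMl ?ltr0n// mulr_natl -[n.+1 in leRHS]card_ord -sumr_const.
by apply: ler_sum => i _; exact: gM.
Qed.

Lemma avg_concentrate (F : nat -> V -> R) : (forall n, bl (F n)) ->
  (forall n x, `|F n x| <= 1) ->
  {ae P, forall w, tends (fun n => avg n (F n) w -
    avg (start R n) (mixtr E (start R n) (n - start R n) (F n)) w) 0}.
Proof.
move=> blF F1.
pose G n j := mixtr E j (n - j) (F n).
have blG n j : bl (G n j) by exact: bl_mixtr.
have G1 n j x : `|G n j x| <= 1 by exact: mixtr_bounded.
have GS n j x : (j < n)%N ->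
    G n j x = (j%:R * G n j.+1 x + tr E (G n j.+1) x) / j.+1%:R.
  by move=> jn; rewrite /G -(subnSK jn) mixtrS.
pose Y n w := mart D U (G n) n w - mart D U (G n) (start R n) w.
have YE n w : Y n w = avg n (F n) w - avg (start R n) (G n (start R n)) w.
  by rewrite /Y /mart /G subnn.
have bY n : bm (Y n).
  by apply: bm_sub; apply: bm_mart.
have [N1 kn] := start_le_id R; have [N2 k0] := start_large R 1.
have ev (m : nat) : {ae P, forall w, exists N, forall n, (N <= n)%N ->
    ~ (m.+1%:R^-1 <= `|Y n w| /\ (maxn N1 N2 <= n)%N)}.
  pose eta : R := m.+1%:R^-1.
  have eta01 : 0 < eta <= 1 by rewrite /eta invr_gt0 ltr0n/= invf_le1// ler1n.
  have c0 : 0 < eta ^+ 2 / 32 by rewrite divr_gt0// exprn_gt0//; case/andP: eta01.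
  have [C [C0 CP]] := expR_start_le c0.
  have mY n : measurable [set w | eta <= `|Y n w|].
    have -> : [set w | eta <= `|Y n w|] = (fun w => `|Y n w|) @^-1` `[eta, +oo[%classic.
      by apply/seteqP; split => w /=; rewrite in_itv/= andbT.
    rewrite -[X in measurable X]setTI.
    have mn : measurable_fun setT (fun w => `|Y n w|).
      by apply: measurableT_comp => //; case: (bY n).
    exact: mn.
  apply: (@borel_cantelli_sq _ _ _ P _ (2 * C)) => n.
    have [h|h] := boolP (maxn N1 N2 <= n)%N.
      rewrite (_ : (fun w => _) = [set w | eta <= `|Y n w|])//.
      by apply/seteqP; split => w //= -[].
    rewrite (_ : (fun w => _) = set0)//.
    by apply/seteqP; split => w //= -[].
  have [h|h] := boolP (maxn N1 N2 <= n)%N; last first.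
    rewrite (_ : (fun w => _) = set0); last by apply/seteqP; split => w //= -[].
    by rewrite measure0 lee_fin !mulr_ge0// invr_ge0 exprn_ge0.
  rewrite (_ : (fun w => _) = [set w | eta <= `|Y n w|]); last first.
    by apply/seteqP; split => w //= -[].
  move: h; rewrite geq_max => /andP[/kn kn' /k0 k0'].
  apply: (le_trans (@azuma _ _ _ _ P D U E E_mean mD mU lawD lawU indep (G n) (start R n) n
    k0' (blG n) (G1 n) _ eta eta01 kn')).
    by move=> j x /andP[_]; exact: GS.
  rewrite lee_fin -[leRHS]mulrA ler_wpM2l//; apply: CP.
  exact: leq_trans kn'.
have := ae_foralln ev; apply: filterS => w H e e0.
have [m me] : exists m, m.+1%:R^-1 < e.
  by have [m _ /(_ m (leqnn _))] := near_infty_natSinv_lt (PosNum e0); exists m.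
have [N NP] := H m; exists (maxn N (maxn N1 N2)) => n; rewrite geq_max => /andP[n1 n2].
rewrite subr0 -YE leNgt; apply/negP => eY; apply: (NP n n1); split => //.
by rewrite (le_trans (ltW me))// ltW.
Qed.

(** Three errors: concentration between times [start n] and [n], replacement of the mixture at the
    early positions by its value at 0, and convergence of that value. The second is at most [B]
    times the early average of [cap], since mixtures keep the modulus of [f]. *)
Lemma avg_tends (f : V -> R) (r : nat -> R) (B c : R) : bl f -> (forall x, `|f x| <= 1) ->
  0 < B -> (forall x y, `|f x - f y| <= B * cap (x - y)) ->
  tends (fun n => mixtr E (start R n) (n - start R n) (fun x => f (r n *: x)) 0) c ->
  {ae P, forall w, tends (fun n => avg (start R n) (fun x => cap (r n *: x)) w) 0} ->
  {ae P, forall w, tends (fun n => avg n (fun x => f (r n *: x)) w) c}.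
Proof.
move=> bf f1 B0 fB mixc capc.
pose F n x := f (r n *: x).
have blF n : bl (F n) by exact: bl_dilate.
have FM n x y : `|F n x - F n y| <= B * cap (r n *: (x - y)).
  by rewrite scalerBr; exact: fB.
have := @avg_concentrate F blF (fun n x => f1 _); move: capc; apply: filterS2 => w Hcap H e e0.
have e30 : 0 < e / 3 by rewrite divr_gt0.
have eB0 : 0 < e / 3 / B by rewrite divr_gt0.
have [N1 P1] := H _ e30; have [N2 P2] := mixc _ e30; have [N3 P3] := Hcap _ eB0.
have [N4 P4] := start_large R 1.
exists (maxn (maxn N1 N2) (maxn N3 N4)) => n; rewrite !geq_max.
move=> /andP[/andP[/P1 h1 /P2 h2] /andP[/P3 h3 /P4 k0]].
set M := mixtr E (start R n) (n - start R n) (F n) in h1 h2.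
have k0' : 0 < (start R n)%:R :> R by rewrite ltr0n.
have h4 : `|avg (start R n) M w - M 0| <= e / 3.
  have -> : avg (start R n) M w - M 0 = avg (start R n) (fun x => M x - M 0) w.
    rewrite sumrB sumr_const card_ord mulrBr -[M 0 *+ _]mulr_natl mulKf//.
    by rewrite gt_eqF.
  rewrite normrM ger0_norm ?invr_ge0//.
  apply: (@le_trans _ _ (avg (start R n) (fun x => B * cap (r n *: x)) w)).
    rewrite ler_wpM2l ?invr_ge0// (le_trans (ler_norm_sum _ _ _))//.
    apply: ler_sum => i _.
    have := mixtr_modulus E_mean (start R n) (n - start R n) (blF n)
      (w := fun x => B * cap (r n *: x)) (FM n) (X i.+1 w) 0.
    by rewrite subr0.
  rewrite -mulr_sumr mulrCA mulrC -ler_pdivlMr//.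
  by move: h3; rewrite subr0 => /ler_normlW.
move: h1; rewrite subr0 => h1.
have -> : avg n (fun x => f (r n *: x)) w - c = (avg n (F n) w - avg (start R n) M w) +
   ((avg (start R n) M w - M 0) + (M 0 - c)) by rewrite /F; ring.
rewrite (le_trans (ler_normD _ _))// [leRHS](_ : e = e / 3 + (e / 3 + e / 3)); last by lra.
by rewrite lerD// (le_trans (ler_normD _ _))// lerD.
Qed.

(** * Tails of the steps and the two scales *)

Section Stable.
Context d1 (Omega1 : measurableType d1) (P1 : probability Omega1 R).
Variables (Lambda : Omega1 -> Rd R d) (alpha : R).
Hypothesis mL : measurable_fun setT Lambda.
Hypothesis alpha0 : 0 < alpha.
Hypothesis weak : forall f : V -> R, bl f ->
  tends (fun n => trn E n (fun x => f (n%:R `^ (- alpha) *: x)) 0)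
        (Rintegral P1 setT (fun w => f (Lambda w))).

Let bcap (r : R) : bl (fun x : V => cap (r *: x)). Proof. exact/bl_dilate/bl_cap. Qed.

Lemma walk_cap_small (eta : R) : 0 < eta -> exists rho e0, 0 < rho /\
  forall e r, (e0 <= e)%N -> 0 <= r <= rho * e%:R `^ (- alpha) ->
    trn E e (fun x => cap (r *: x)) 0 <= eta.
Proof.
move=> eta0; have eta20 : 0 < eta / 2 by rewrite divr_gt0.
have [rho [rho0 rhoL]] := Ex_cap_small P1 mL eta20.
have [e0 He] := weak (bcap rho) eta20.
exists rho, e0; split => // e r ee /andP[r0 rr].
apply: (@le_trans _ _ (trn E e (fun x => cap (rho *: (e%:R `^ (- alpha) *: x))) 0)).
  apply: trn_le => // [|x]; first exact: (bl_dilate (e%:R `^ (- alpha)) (bcap rho)).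
  by rewrite scalerA; apply: cap_scale_le; rewrite r0.
by have := He e ee => /ler_normlW; lra.
Qed.

(** Covers the finitely many times about which the limit says nothing: each sum is a single random
    vector, hence tight. *)
Lemma walk_cap_small_fixed (eta : R) l0 : 0 < eta -> exists rho, 0 < rho /\
  forall l r, (l < l0)%N -> 0 <= r <= rho -> trn E l (fun x => cap (r *: x)) 0 <= eta.
Proof.
move=> eta0; elim: l0 => [|l0 [rho [rho0 IH]]]; first by exists 1.
pose S w : V := \sum_(1 <= i < l0.+1) (D i w : V).
have mS : measurable_fun setT (S : Omega -> Rd R d).
  rewrite /S; under eq_fun do rewrite big_add1/= big_mkord.
  by apply: measurable_Rd_sum => i; exact: mD.
have [rho' [rho'0 rhoS]] := Ex_cap_small P mS eta0.
exists (Num.min rho rho'); split; first by rewrite lt_min rho0.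
move=> l r; rewrite ltnS leq_eqVlt => /predU1P[->|ll] /andP[r0]; rewrite le_min => /andP[r1 r2].
  apply: (@le_trans _ _ (trn E l0 (fun x => cap (rho' *: x)) 0)).
    by apply: trn_le => // x; apply: cap_scale_le; rewrite r0.
  by rewrite -(Ex_sum_steps E_mean mD mU lawD indep _ (bcap rho')).
by apply: IH => //; rewrite r0.
Qed.

(** With [t = T * m.+1 ^ alpha], tightness makes all sums of at most [m.+1] steps small at scale
    [t], so [one_step_tail] applies. In effect a step exceeds [32 * t] with probability at most
    [1 / m]. *)
Lemma steps_tail : exists T : R, 0 < T /\ forall m : nat,
  m%:R * E (ramp (16 * (T * m.+1%:R `^ alpha))) <= 1.
Proof.
have q0 : 0 < 4^-1 :> R by rewrite invr_gt0.
have [rho [e0 [rho0 He]]] := walk_cap_small q0.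
(* The maximum with 1 sends time 0, where the negative power is meaningless, to the fixed times. *)
have [rho' [rho'0 Hl]] := walk_cap_small_fixed (maxn e0 1) q0.
pose s := Num.min rho rho'.
have s0 : 0 < s by rewrite lt_min rho0.
exists s^-1; split; first by rewrite invr_gt0.
move=> m; set t := s^-1 * _.
have m1 : 1 <= m.+1%:R `^ alpha.
  have e1 : 1 `^ alpha = 1 :> R by rewrite powR1.
  by rewrite -[leLHS]e1 ge0_ler_powR ?nnegrE ?(ltW alpha0)// ler1n.
have p0 : 0 < m.+1%:R `^ alpha by apply: lt_le_trans m1.
have t0 : 0 < t by rewrite mulr_gt0 ?invr_gt0.
apply: one_step_tail => // l lm.
apply: (@le_trans _ _ (trn E l (fun x => cap (t^-1 *: x)) 0)).
  by apply: trn_le => // [|x]; [exact: bl_ramp|exact: ramp_le_cap].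
have tE : t^-1 = s * (m.+1%:R `^ alpha)^-1 by rewrite /t invfM invrK.
have [ll|ll] := ltnP l (maxn e0 1).
  apply: Hl => //; rewrite invr_ge0 ltW//= tE.
  apply: (@le_trans _ _ s); last by rewrite ge_min lexx orbT.
  by rewrite ler_piMr ?(ltW s0)// invf_le1.
move: ll; rewrite geq_max => /andP[el l1].
apply: He => //; rewrite invr_ge0 ltW//= tE.
apply: ler_pM; [exact: ltW|by rewrite invr_ge0 ltW|by rewrite ge_min lexx|].
rewrite powRN lef_pV2 ?posrE ?powR_gt0 ?ltr0n//.
by rewrite ge0_ler_powR ?nnegrE// ?(ltW alpha0)// ler_nat.
Qed.

(** Taking [m = i.+1 ^ 2] in [steps_tail] gives summable probabilities for thresholds of order
    [i^(2 alpha)]; the finitely many exceptional steps go into the constant. *)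
Lemma steps_poly_bound : {ae P, forall w, exists q (B : R), 0 <= B /\ forall k,
  \sum_(i < k) `|D i.+1 w : V| <= B * (k.+1%:R) ^+ q}.
Proof.
have [T [T0 HT]] := steps_tail.
pose t i := T * (i.+1 ^ 2).+1%:R `^ alpha.
have t0 i : 0 < t i by rewrite mulr_gt0// powR_gt0.
have t16 i : 0 < 16 * t i by rewrite mulr_gt0.
pose q := (Num.truncn (2 * alpha)).+1.
have aq : 2 * alpha <= q%:R.
  have : 0 <= 2 * alpha by rewrite mulr_ge0// ltW.
  by move=> /truncn_itv/andP[_ /ltW].
have tq i : 32 * t i <= 32 * T * i.+2%:R ^+ q.
  rewrite /t mulrA ler_wpM2l ?mulr_ge0 ?(ltW T0)// -powR_mulrn//.
  apply: (@le_trans _ _ (i.+2%:R `^ (2 * alpha))); last by rewrite ler_powR// ler1n.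
  rewrite powRrM powR_mulrn// -natrX ge0_ler_powR ?nnegrE ?(ltW alpha0)// ler_nat.
  by rewrite -[i.+2]addn1 sqrnD -addn1 -addnA leq_add2l exp1n leq_addr.
have mA i : measurable [set w | 32 * t i <= `|D i.+1 w : V|].
  have mn : measurable_fun setT (fun w => `|D i.+1 w : V|).
    have mV : measurable_fun setT (fun x : Rd R d => `|x : V|).
      by apply: continuous_measurable_Rd; exact: norm_continuous.
    by apply: (measurableT_comp mV); exact: mD.
  have -> : [set w | 32 * t i <= `|D i.+1 w : V|] =
      (fun w => `|D i.+1 w : V|) @^-1` `[32 * t i, +oo[%classic.
    by apply/seteqP; split => w /=; rewrite in_itv/= andbT.
  by rewrite -[X in measurable X]setTI; exact: mn.
have PA i : (P [set w | (32 * t i <= `|D i.+1 w : V|)%R] <= (1 * i.+1%:R ^- 2)%:E)%E.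
  rewrite -Ex_indic// lee_fin mul1r.
  apply: (@le_trans _ _ (E (ramp (16 * t i)))).
    rewrite -(lawD i (bl_ramp d (t16 i))); apply: Ex_le.
    - exact: bm_indic.
    - by apply: (bm_comp _ (bl_bm (bl_ramp d (t16 i)))); exact: mD.
    - move=> w; rewrite indicE; case: (boolP (w \in _)) => [|_]; last exact: ramp_ge0.
      by rewrite inE/= => h; rewrite ramp_eq1//; lra.
  have := HT (i.+1 ^ 2)%N; rewrite -/(t i) natrX => h.
  by rewrite -div1r ler_pdivlMr ?exprn_gt0// mulrC.
have := borel_cantelli_sq mA PA; apply: filterS => w [N HN].
pose SN := \sum_(i < N) `|D i.+1 w : V|.
have SN0 : 0 <= SN by exact: sumr_ge0.
exists q.+1, (SN + 32 * T); split; first by rewrite addr_ge0// mulr_ge0// ltW.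
have T320 : 0 <= 32 * T by rewrite mulr_ge0// ltW.
have mono k : (k <= N)%N -> \sum_(i < k) `|D i.+1 w : V| <= SN.
  rewrite /SN -!(big_mkord predT (fun i => `|D i.+1 w : V|)) => kN.
  by rewrite (big_cat_nat _ kN)//= lerDl sumr_ge0.
have bound k : \sum_(i < k) `|D i.+1 w : V| <= SN + k%:R * (32 * T * k.+1%:R ^+ q).
  elim: k => [|k IH]; first by rewrite big_ord0 mul0r addr0.
  have c0 j : 0 <= 32 * T * j%:R ^+ q by rewrite mulr_ge0// exprn_ge0.
  have [kN|Nk] := ltnP k N.
    by rewrite (le_trans (mono _ kN))// lerDl mulr_ge0.
  rewrite big_ord_recr/=.
  have hk : `|D k.+1 w : V| <= 32 * T * k.+2%:R ^+ q.
    apply: le_trans (tq k); apply: ltW; rewrite ltNge; apply/negP => h.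
    exact: (HN k Nk).
  have mo : k%:R * (32 * T * k.+1%:R ^+ q) <= k%:R * (32 * T * k.+2%:R ^+ q).
    by rewrite ler_wpM2l// ler_wpM2l// lerXn2r ?nnegrE// ler_nat.
  rewrite -[in k.+1%:R * _]natr1 mulrDl mul1r; lra.
move=> k; apply: (le_trans (bound k)).
have k1 : 1 <= k.+1%:R ^+ q.+1 :> R by rewrite expr_ge1// ler1n.
rewrite [leRHS]mulrDl lerD//; first by rewrite ler_peMr.
rewrite mulrCA ler_wpM2l// exprS ler_wpM2r ?exprn_ge0// ler_nat.
exact: leqnSn.
Qed.

(** A walk of about [log n] steps has size of order [(log n)^alpha], far below [n^(alpha/2)], and
    the early positions are polynomial in [(log n)^2]. *)
Lemma avg_cap_tends : {ae P, forall w,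
  tends (fun n => avg n (fun x => cap (n%:R `^ (- (alpha / 2)) *: x)) w) 0}.
Proof.
apply: (@avg_tends (@cap R d) (fun n => n%:R `^ (- (alpha / 2))) 1 0) => //.
- exact: bl_cap.
- by move=> x; rewrite ger0_norm ?cap_ge0 ?cap_le1.
- by move=> x y; rewrite mul1r cap_modulus.
- apply: (@mixtr_tends _ _ _ E_mean (fun n x => cap (n%:R `^ (- (alpha / 2)) *: x))).
  + by move=> n; exact: bcap.
  + by move=> n x; rewrite ger0_norm ?cap_ge0 ?cap_le1.
  + by rewrite normr0.
  move=> eta eta0; have [rho [e0 [rho0 He]]] := walk_cap_small eta0.
  have [N1 H1] := lnn_large (2 * (e0%:R + 1) : R).
  (* Ensures [n^(- alpha/2) <= rho * e^(- alpha)] for [e <= 3/2 * lnn n]: the tangent to [ln] at 8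
     gives [ln e <= 3/16 * lnn n - 1 + ln 8]. *)
  have [N2 H2] := lnn_large (4 * (ln 8 - ln rho / alpha)).
  exists 2^-1, (maxn (maxn N1 N2) 1); split; first by rewrite invr_gt0.
  move=> n e; rewrite !geq_max => /andP[/andP[/H1 L1 /H2 L2] n0].
  rewrite ler_norml => /andP[l1 l2].
  have ee : e0%:R + 1 <= e%:R :> R by lra.
  have ee0 : (e0.+1 <= e)%N by rewrite -(ler_nat R) -natr1.
  have e1 : 0 < e%:R :> R by rewrite ltr0n (leq_trans _ ee0).
  rewrite subr0 ger0_norm; last first.
    by rewrite -[leLHS](trn_cst E_mean e 0 0); apply: trn_le => // *;
      [exact: bl_cst|exact: cap_ge0].
  apply: He; first exact: ltnW.
  rewrite powR_ge0/= powRE ?ltr0n// powRE// -[X in _ <= X * _](lnK rho0) -expRD ler_expR.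
  have t8 : 0 < 8 :> R by [].
  have := ln_le_scaled t8 e1; rewrite -/(lnn R n) => l3.
  have l4 : alpha * (ln e%:R - lnn R n / 2) <= alpha * (ln rho / alpha).
    by rewrite ler_pM2l//; lra.
  move: l4; rewrite [alpha * (ln rho / alpha)]mulrC divfK ?gt_eqF//; lra.
- have := steps_poly_bound; apply: filterS => w [q [B [B0 HB]]] e e0.
  have a20 : 0 < alpha / 2 by rewrite divr_gt0.
  have [N HN] := poly_start_expR q B a20 e0.
  exists (maxn N 1) => n; rewrite geq_max => /andP[/HN h n0].
  rewrite subr0 ger0_norm; last first.
    by rewrite mulr_ge0 ?invr_ge0// sumr_ge0// => i _; exact: cap_ge0.
  have rE : n%:R `^ (- (alpha / 2)) = expR (- (alpha / 2 * lnn R n)).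
    by rewrite powRE ?ltr0n// mulNr.
  apply: (@le_trans _ _ (B * (start R n).+1%:R ^+ q * expR (- (alpha / 2 * lnn R n)))); last first.
    by move: h; rewrite subr0 => /ler_normlW.
  apply: (@avg_bound _ (fun x => cap (n%:R `^ (- (alpha / 2)) *: x))) => [|i ik].
    by rewrite !mulr_ge0 ?exprn_ge0// expR_ge0.
  rewrite (le_trans (cap_le_norm _))// normrZ ger0_norm ?powR_ge0// rE mulrC.
  rewrite ler_wpM2r ?expR_ge0//; apply: le_trans (HB _).
  by rewrite /X -(@nth_Xseq _ _ _ _ _ _ ik) nth_Xseq_norm.
Qed.

Lemma trn_dist e (f g : V -> R) (c : R) x : bl f -> bl g ->
  (forall x, `|f x - g x| <= c) -> `|trn E e f x - trn E e g x| <= c.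
Proof.
move=> bf bg fg; elim: e x => //= e IH x; apply: (mean_dist E_mean) => [| |y].
- exact/bl_shift/bl_trn.
- exact/bl_shift/bl_trn.
- exact: IH.
Qed.

(** The hypothesis concerns the scale [e^alpha] with [e] the number of steps; for [e] close to
    [lnn n] the two scales differ by a dilation close to 1, harmless for compactly supported [f]. *)
Lemma avg_tends_compact (f : V -> R) (rad : R) : bl f -> (forall x, `|f x| <= 1) ->
  0 < rad -> (forall x, rad <= `|x| -> f x = 0) ->
  {ae P, forall w, tends (fun n => avg n (fun x => f ((lnn R n `^ alpha)^-1 *: x)) w)
    (Rintegral P1 setT (fun w => f (Lambda w)))}.
Proof.
move=> bf f1 rad0 frad; have [B B0 fB] := bl_modulus bf.
apply: (@avg_tends f _ B _ bf f1 B0 fB).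
- apply: (@mixtr_tends _ _ _ E_mean (fun n x => f ((lnn R n `^ alpha)^-1 *: x))).
  + by move=> n; exact: bl_dilate.
  + by move=> n x; exact: f1.
  + have bfL : bm (fun w => f (Lambda w)) by exact: (bm_comp mL (bl_bm bf)).
    rewrite ler_norml; apply/andP; split.
      rewrite -[leLHS](Ex_cst P1); apply: Ex_le => // [|w]; first exact: bm_cst.
      by have := f1 (Lambda w); rewrite ler_norml => /andP[].
    rewrite -[leRHS](Ex_cst P1); apply: Ex_le => // [|w]; first exact: bm_cst.
    by have := f1 (Lambda w); rewrite ler_norml => /andP[].
  move=> eta eta0; have eta20 : 0 < eta / 2 by rewrite divr_gt0.
  have [delta delta0 Hd] := dilate_near1 bf rad0 eta20 frad.
  have [tau tau0 Ht] := powR_near1 alpha delta0.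
  have [e1 He] := weak bf eta20.
  have [N1 H1] := lnn_large (2 * (e1%:R + 1) : R).
  exists (Num.min tau 2^-1), N1; split; first by rewrite lt_min tau0 invr_gt0 ltr0n.
  move=> n e /H1 L1 h.
  have e10 : 0 <= e1%:R :> R by [].
  have L0 : 0 < lnn R n by lra.
  have /andP[h1 h2] : (`|e%:R - lnn R n| <= tau * lnn R n) &&
      (`|e%:R - lnn R n| <= 2^-1 * lnn R n).
    by rewrite !(le_trans h)// ler_wpM2r ?ge_min ?lexx ?orbT// ltW.
  have ee : e1%:R + 1 <= e%:R :> R by move: h2; rewrite ler_norml => /andP[]; lra.
  have ee0 : (e1.+1 <= e)%N by rewrite -(ler_nat R) -natr1.
  have e0 : 0 < e%:R :> R by rewrite ltr0n (leq_trans _ ee0).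
  pose rho := (e%:R / lnn R n) `^ alpha.
  have rhoE : (lnn R n `^ alpha)^-1 = rho * e%:R `^ (- alpha).
    rewrite /rho -powRN !powRE ?divr_gt0// -expRD ln_div ?posrE//.
    by congr expR; ring.
  have rho1 : `|rho - 1| <= delta.
    apply: Ht; have -> : e%:R / lnn R n - 1 = (e%:R - lnn R n) / lnn R n.
      by field; rewrite gt_eqF.
    by rewrite normrM (gtr0_norm (_ : 0 < (lnn R n)^-1)) ?invr_gt0// ler_pdivrMr.
  have -> : trn E e (fun x => f ((lnn R n `^ alpha)^-1 *: x)) 0 -
      Rintegral P1 setT (fun w => f (Lambda w)) =
      (trn E e (fun x => f ((lnn R n `^ alpha)^-1 *: x)) 0 -
       trn E e (fun x => f (e%:R `^ (- alpha) *: x)) 0) +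
      (trn E e (fun x => f (e%:R `^ (- alpha) *: x)) 0 -
       Rintegral P1 setT (fun w => f (Lambda w))) by ring.
  rewrite (le_trans (ler_normD _ _))// [leRHS](_ : eta = eta / 2 + eta / 2); last by lra.
  apply: lerD; last by apply: He; exact: ltnW.
  apply: trn_dist => [| |x]; [exact: bl_dilate..|].
  by rewrite rhoE -scalerA; exact: Hd.
(* The previous estimate is read at index [start n], which tends to infinity;
   [start n <= lnn n ^+ 2] compares the scales. *)
- have := avg_cap_tends; apply: filterS => w H e e0.
  have [N1 H1] := H e e0; have [N2 H2] := start_large R (maxn N1 1).
  have [N3 H3] := lnn_large (1 : R).
  exists (maxn N2 N3) => n; rewrite geq_max => /andP[/H2 k /H3 L1].
  move: k; rewrite geq_max => /andP[kN k0].
  have := H1 _ kN; rewrite !subr0; apply: le_trans.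
  have k0' : 0 < (start R n)%:R :> R by rewrite ltr0n.
  have avg0 (r : R) : 0 <= avg (start R n) (fun x => cap (r *: x)) w.
    by rewrite mulr_ge0 ?invr_ge0// sumr_ge0// => i _; exact: cap_ge0.
  rewrite !ger0_norm// ler_wpM2l ?invr_ge0//; apply: ler_sum => i _.
  have L0 : 0 < lnn R n by lra.
  apply: cap_scale_le; rewrite invr_ge0 powR_ge0/= -powRN !powRE// ler_expR.
  have := start_le R n; rewrite -(ler_ln _ (exprn_gt0 _ L0)) ?posrE// lnXn// => h.
  have := ler_wpM2l (ltW alpha0) h; rewrite -mulr_natr; lra.
Qed.

End Stable.
End ScalingLimit.

(** * Weak convergence *)

Section TestFunctions.
Variables (R : realType) (d : nat).
Local Notation V := 'rV[R]_d.
Local Notation code := (rat * nat * 'rV[rat]_d)%type.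
Implicit Types (c : code) (s : seq code).

(** Height, slope and centre are rational, so that one null set serves all of them; the support is
    bounded. *)
Definition tent c (x : V) : R :=
  Num.max 0 (ratr c.1.1 - c.1.2.+1%:R * `|x - map_mx ratr c.2|).

Definition tents s (x : V) : R := foldr (fun c y => Num.max (tent c x) y) 0 s.

Lemma tent_le c x : tent c x <= `|ratr c.1.1|.
Proof.
rewrite ge_max normr_ge0/=; apply: le_trans (ler_norm _).
by rewrite gerBl mulr_ge0.
Qed.

Lemma tent_ge0 c x : 0 <= tent c x.
Proof. by rewrite le_max lexx. Qed.

Lemma maxr_dist (a b a' b' : R) :
  `|Num.max a b - Num.max a' b'| <= `|a - a'| + `|b - b'|.
Proof.
have := ler_norm (a - a'); have := ler_norm (a' - a); rewrite (distrC a' a).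
have := ler_norm (b - b'); have := ler_norm (b' - b); rewrite (distrC b' b).
have := normr_ge0 (a - a'); have := normr_ge0 (b - b').
move: `|a - a'| `|b - b'| => u v ? ? ? ? ? ?; rewrite ler_norml.
by case: (leP a b) => ?; case: (leP a' b') => ?; apply/andP; split; lra.
Qed.

Lemma bl_maxr (f g : V -> R) : bl f -> bl g -> bl (fun x => Num.max (f x) (g x)).
Proof.
move=> [[M fM] [C fC]] [[N gN] [D gD]]; split.
  exists (M + N) => x; have := maxr_dist (f x) (g x) 0 0; rewrite maxxx !subr0.
  by move=> h; rewrite (le_trans h)// lerD.
by exists (C + D) => x y; rewrite mulrDl (le_trans (maxr_dist _ _ _ _))// lerD.
Qed.

Lemma bl_tent c : bl (tent c).
Proof.
split.
  by exists (`|ratr c.1.1| : R) => x; rewrite (ger0_norm (tent_ge0 c x)); exact: tent_le.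
exists c.1.2.+1%:R => x y; rewrite (le_trans (maxr_dist _ _ _ _))// subrr normr0 add0r.
rewrite opprB addrC addrA subrK -mulrBr normrM ger0_norm// ler_wpM2l//.
rewrite (le_trans (ler_dist_dist _ _))// opprB addrA subrK distrC.
exact: lexx.
Qed.

Lemma bl_tents s : bl (tents s).
Proof. by elim: s => [|c s IH] /=; [exact: bl_cst|exact: (bl_maxr (bl_tent c))]. Qed.

Lemma tents_ge0 s x : 0 <= tents s x.
Proof. by case: s => //= c s; rewrite le_max tent_ge0. Qed.

Lemma tent_le_tents s c x : c \in s -> tent c x <= tents s x.
Proof.
elim: s => //= a s IH; rewrite in_cons le_max => /predU1P[->|/IH ->].
  by rewrite lexx.
by rewrite orbT.
Qed.

Lemma tents_le s x (M : R) : 0 <= M -> (forall c, c \in s -> tent c x <= M) ->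
  tents s x <= M.
Proof.
move=> M0; elim: s => //= a s IH sM; rewrite ge_max sM ?mem_head//=.
by apply: IH => c cs; apply: sM; rewrite in_cons cs orbT.
Qed.

Lemma tent_support c x :
  `|map_mx ratr c.2 : V| + `|ratr c.1.1| <= `|x| -> tent c x = 0.
Proof.
move=> h; apply/max_idPl; rewrite subr_le0 (le_trans (ler_norm _))//.
have h1 : `|ratr c.1.1| <= `|x - map_mx ratr c.2|.
  rewrite -(lerD2l `|map_mx ratr c.2 : V|) (le_trans h)// addrC.
  by rewrite -{1}(subrK (map_mx ratr c.2) x) ler_normD.
by rewrite (le_trans h1)// ler_peMl// ler1n.
Qed.

Lemma tents_support s : exists2 rad : R, 0 < rad & forall x, rad <= `|x| -> tents s x = 0.
Proof.
elim: s => [|c s [rad rad0 IH]] /=; first by exists 1.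
exists (Num.max rad (`|map_mx ratr c.2 : V| + `|ratr c.1.1|)).
  by rewrite lt_max rad0.
by move=> x; rewrite ge_max => /andP[h1 h2]; rewrite IH// tent_support// maxxx.
Qed.

(** The height lies within [e / 4] below [v], the slope is steep enough to confine the tent to the
    neighbourhood where [f > v], and the centre is so close to [x] that the slope costs less than
    [e / 4]. If [v <= 0] the zero tent suffices. *)
Lemma tent_approx (f : V -> R) x (e : R) : continuous f -> (forall y, 0 <= f y) -> 0 < e ->
  exists c, (forall y, tent c y <= f y) /\ f x - e <= tent c x.
Proof.
move=> cf f0 e0.
pose v := f x - e / 4.
have [v0|v0] := leP v 0.
  exists (0, 0%N, 0); split => [y|].
    by rewrite (le_trans (tent_le _ _))//= rmorph0 normr0.
  by apply: le_trans (tent_ge0 _ _); rewrite /v in v0; lra.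
have [r r0 rv] : exists2 r, 0 < r & forall y, `|x - y| < r -> v < f y.
  have : nbhs x (f @^-1` [set z | v < z]).
    apply: (cf x); apply: (@open_nbhs_nbhs R); split; first exact: open_gt.
    by rewrite /= /v; lra.
  move=> /nbhs_ballP[r /= r0 H]; exists r => // y xy.
  by apply: H; rewrite -ball_normE.
have [a] := @rat_in_itvoo R (v - e / 4) v ltac:(lra).
rewrite in_itv/= => /andP[a1 a2].
have [k kP] : exists k : nat, 2 * v / r < k.+1%:R.
  have : 0 <= 2 * v / r by rewrite divr_ge0 ?mulr_ge0// ltW.
  by move=> /truncn_itv/andP[_]; exists (Num.truncn (2 * v / r)).
have k0 : 0 < k.+1%:R :> R by rewrite ltr0n.
have kr : v < k.+1%:R * (r / 2).
  by move: kP; rewrite ltr_pdivrMr// mulrA ltr_pdivlMr// mulrC.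
have [q] := @rat_dense_rV R d x (Num.min (r / 2) (e / 4 / k.+1%:R))
  ltac:(by rewrite lt_min !divr_gt0).
rewrite lt_min => /andP[q1 q2].
exists (a, k, q); split => [y|] /=.
  have [b0|b0] := leP (tent (a, k, q) y) 0; first exact: le_trans (f0 y).
  have hb : 0 < ratr a - k.+1%:R * `|y - map_mx ratr q|.
    by move: b0; rewrite /tent/= lt_max ltxx.
  have yq : `|y - map_mx ratr q| < r / 2.
    rewrite -(ltr_pM2l k0); apply: le_lt_trans kr; lra.
  have xy : `|x - y| < r.
    rewrite (le_lt_trans (ler_distD (map_mx ratr q) _ _))//.
    by rewrite [ltRHS]splitr ltrD// distrC.
  have := rv _ xy => vy; rewrite /tent/= max_r ?(ltW hb)//.
  have : 0 <= k.+1%:R * `|y - map_mx ratr q| by rewrite mulr_ge0.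
  lra.
rewrite le_max; apply/orP; right => /=.
move: q2; rewrite ltr_pdivlMr// mulrC => q2; rewrite /v in a1; lra.
Qed.

Lemma tents_approx dT (T : measurableType dT) (P : probability T R) (Y : T -> Rd R d)
    (f : V -> R) (M e : R) : measurable_fun setT Y -> continuous f ->
  (forall y, 0 <= f y <= M) -> 0 < e ->
  exists s, (forall y, tents s y <= f y) /\
    Rintegral P setT (fun w => f (Y w)) - e <= Rintegral P setT (fun w => tents s (Y w)).
Proof.
move=> mY cf fM e0.
(* All tents below [f] among the first [n] codes; their maximum converges to [f] pointwise. *)
pose s n : seq code :=
  [seq c <- pmap choice.unpickle (iota 0 n) | `[< forall y, tent c y <= f y >]].
have sf n y : tents (s n) y <= f y.
  apply: tents_le => [|c]; first by case/andP: (fM y).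
  by rewrite mem_filter => /andP[/asboolP].
have : tends (fun n => Rintegral P setT (fun w => tents (s n) (Y w)))
   (Rintegral P setT (fun w => f (Y w))).
  apply: (@bounded_convergence _ _ _ P _ _ M) => [n||n w|w eta eta0].
  - by case: (bm_comp mY (bl_bm (bl_tents (s n)))).
  - exact: (measurableT_comp (continuous_measurable_Rd cf) mY).
  - by rewrite ger0_norm ?tents_ge0// (le_trans (sf n _))//; case/andP: (fM (Y w)).
  have f0 y : 0 <= f y by case/andP: (fM y).
  have [c [cf' cx]] := tent_approx (Y w) cf f0 eta0.
  exists (choice.pickle c).+1 => n cn.
  have cs : c \in s n.
    rewrite mem_filter asboolT//= mem_pmap; apply/mapP; exists (choice.pickle c).
      by rewrite mem_iota.
    by rewrite choice.pickleK.
  have h1 := tent_le_tents (Y w) cs; have h2 := sf n (Y w).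
  by rewrite distrC ger0_norm ?subr_ge0//; lra.
move=> /(_ e e0)[N /(_ N (leqnn N))]; rewrite ler_norml => /andP[h _].
by exists (s N); split => //; lra.
Qed.

End TestFunctions.

(** * Integrals against the rescaled empirical measure *)

Section EmpiricalIntegral.
Context (R : realType) (d : nat).
Local Notation V := 'rV[R]_d.

Let invn_ge0 n : 0 <= n%:R^-1 :> R. Proof. by rewrite invr_ge0. Qed.

(** Rewrites a bare set function as a scaled sum of Dirac measures, to which the integration lemmas
    apply. *)
Lemma Theta_empiricalE (x : nat -> V) (a : R) n : Theta a (mdiv (empirical x n) n%:R) =
  mscale (NngNum (invn_ge0 n))
    (msum (fun i => \d_(a^-1 *: x i.+1 : Rd R d)) n).
Proof.
apply/funext => A; rewrite /Theta /mdiv /empirical /pushforward /mscale/= /msum/=.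
by congr (_ * _)%E; rewrite big_add1/= big_mkord.
Qed.

Lemma integral_Theta_empirical (x : nat -> V) (a : R) n (f : V -> R) : continuous f ->
  (\int[ Theta a (mdiv (empirical x n) n%:R)]_y (f y)%:E =
   (n%:R^-1 * \sum_(i < n) f (a^-1 *: x i.+1))%:E)%E.
Proof.
move=> cf; rewrite Theta_empiricalE.
have mf : measurable_fun setT (EFin \o f : Rd R d -> \bar R).
  by apply/measurable_EFinP; exact: continuous_measurable_Rd.
have pos (g : Rd R d -> \bar R) : measurable_fun setT g -> (forall y, (0 <= g y)%E) ->
  (\int[mscale (NngNum (invn_ge0 n))
    (msum (fun i => \d_(a^-1 *: x i.+1 : Rd R d)) n)]_y g y =
   (n%:R^-1)%:E * \sum_(i < n) g (a^-1 *: x i.+1 : Rd R d))%E.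
  move=> mg g0; rewrite ge0_integral_mscale//= ge0_integral_measure_sum//.
  congr (_ * _)%E; apply: eq_bigr => i _; rewrite integral_dirac//.
  by rewrite diracT mul1e.
rewrite integralE !pos//; [|exact: measurable_funeneg|exact: measurable_funepos].
have funposE y : (EFin \o f)^\+%E y = (Num.max (f y) 0)%:E.
  by rewrite funeposE /= EFin_max.
have funnegE y : (EFin \o f)^\-%E y = (Num.max (- f y) 0)%:E.
  by rewrite funenegE /= EFin_max.
under eq_bigr do rewrite funposE.
under [X in (_ - _ * X)%E]eq_bigr do rewrite funnegE.
rewrite !sumEFin -!EFinM -EFinB -mulrBr -sumrB; congr (_ * _)%:E.
apply: eq_bigr => i _; move: (f _) => z.
by case: (leP z 0) => ?; case: (leP (- z) 0) => ?; lra.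
Qed.

End EmpiricalIntegral.

Lemma eq_law_Rintegral (R : realType) d1 (T1 : measurableType d1) d2 (T2 : measurableType d2)
    dV (W : measurableType dV) (P1 : probability T1 R) (P2 : probability T2 R)
    (X1 : T1 -> W) (X2 : T2 -> W) (f : W -> R) :
  measurable_fun setT X1 -> measurable_fun setT X2 ->
  (forall B, measurable B -> P1 (X1 @^-1` B) = P2 (X2 @^-1` B)) -> bm f ->
  Rintegral P1 setT (f \o X1) = Rintegral P2 setT (f \o X2).
Proof.
move=> m1 m2 law bf; have [mf _] := bf.
pose x1 := isMeasurableFun.Build _ _ _ _ _ m1.
pose Y1 : {mfun T1 >-> W} := HB.pack X1 x1.
pose x2 := isMeasurableFun.Build _ _ _ _ _ m2.
pose Y2 : {mfun T2 >-> W} := HB.pack X2 x2.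
apply: EFin_inj; rewrite !EFin_Ex; [|exact: bm_comp m2 bf|exact: bm_comp m1 bf].
have mfE : measurable_fun setT (EFin \o f) by exact/measurable_EFinP.
transitivity (\int[distribution P1 Y1]_y (EFin \o f) y)%E.
  rewrite integral_distribution//.
  by apply: (bm_integrable P1 (f := f \o X1)); exact: bm_comp m1 bf.
transitivity (\int[distribution P2 Y2]_y (EFin \o f) y)%E.
  by apply: eq_measure_integral => B mB _; exact: law.
rewrite integral_distribution//.
by apply: (bm_integrable P2 (f := f \o X2)); exact: bm_comp m2 bf.
Qed.

Lemma integral_pushforward_Ex (R : realType) d1 (T1 : measurableType d1)
    dV (W : measurableType dV) (P1 : probability T1 R) (X1 : T1 -> W) (f : W -> R) :
  measurable_fun setT X1 -> bm f ->
  (\int[pushforward P1 X1]_y (f y)%:E = (Rintegral P1 setT (f \o X1))%:E)%E.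
Proof.
move=> m1 bf; have [mf _] := bf.
have b1 : bm (f \o X1) by exact: bm_comp m1 bf.
rewrite EFin_Ex//.
pose x1 := isMeasurableFun.Build _ _ _ _ _ m1.
pose Y1 : {mfun T1 >-> W} := HB.pack X1 x1.
rewrite -[LHS]/(\int[distribution P1 Y1]_y (EFin \o f) y)%E integral_distribution//.
  exact/measurable_EFinP.
exact: bm_integrable b1.
Qed.

Lemma is_mean_law (R : realType) (d : nat) d0 (T : measurableType d0) (P : probability T R)
    (Y : T -> Rd R d) : measurable_fun setT Y ->
  is_mean (fun f : 'rV[R]_d -> R => Rintegral P setT (fun w => f (Y w))).
Proof.
move=> mY; have bY (f : 'rV[R]_d -> R) : bl f -> bm (fun w => f (Y w)).
  by move=> bf; exact: (bm_comp mY (bl_bm bf)).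
split=> [a f g bf bg|f g bf bg fg|c]; last exact: Ex_cst.
- by rewrite Ex_add ?Ex_scale//; [exact: bY|exact/bm_scale/bY|exact: bY].
- by apply: Ex_le => //; exact: bY.
Qed.

(** * From tents to bounded continuous functions *)

Section WeakLimit.
Context (R : realType) (d : nat) dO (Omega : measurableType dO) (P : probability Omega R).
Local Notation V := 'rV[R]_d.
Variables (x : nat -> Omega -> V) (r : nat -> R).
Context d1 (Omega1 : measurableType d1) (P1 : probability Omega1 R).
Variable Lambda : Omega1 -> Rd R d.
Hypothesis mL : measurable_fun setT Lambda.

Local Notation avg n f w := (n%:R^-1 * \sum_(i < n) f (r n *: x i.+1 w)).

Hypothesis avg_compact : forall (f : V -> R) (rad : R), bl f -> (forall x, `|f x| <= 1) ->
  0 < rad -> (forall x, rad <= `|x| -> f x = 0) ->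
  {ae P, forall w, tends (fun n => avg n f w) (Rintegral P1 setT (fun w => f (Lambda w)))}.

Lemma avg_tends_tents s : {ae P, forall w,
  tends (fun n => avg n (@tents R d s) w)
    (Rintegral P1 setT (fun w => @tents R d s (Lambda w)))}.
Proof.
have bs := bl_tents R s; have [[M sM] _] := bs; have [rad rad0 supp] := tents_support R s.
pose c := `|M| + 1; have c0 : 0 < c by rewrite ltr_wpDl.
have c0' : c != 0 by rewrite gt_eqF.
have bf : bl (fun y => c^-1 * @tents R d s y) by exact: bl_scaled.
have f1 y : `|c^-1 * @tents R d s y| <= 1.
  rewrite normrM gtr0_norm ?invr_gt0// ler_pdivrMl// mulr1 (le_trans (sM y))//.
  by rewrite (le_trans (ler_norm M))// lerDl.
have f0 y : rad <= `|y| -> c^-1 * @tents R d s y = 0 by move=> /supp ->; rewrite mulr0.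
have := avg_compact bf f1 rad0 f0; apply: filterS => w H e e0.
have [N HN] := H (e / c) (divr_gt0 e0 c0); exists N => n /HN.
rewrite Ex_scale; last exact: (bm_comp mL (bl_bm bs)).
rewrite -mulr_sumr mulrCA -mulrBr normrM gtr0_norm ?invr_gt0// mulrC.
by rewrite ler_pM2r ?invr_gt0.
Qed.

(** Approximation from below yields lower bounds for nonnegative functions. Applied to [f + M] and
    to [M - f], they give both bounds for [f], as the total masses agree. *)
Lemma avg_tends_continuous : {ae P, forall w, forall f : V -> R, continuous f ->
  (exists M : R, forall x, `|f x| <= M) ->
  tends (fun n => avg n f w) (Rintegral P1 setT (fun w => f (Lambda w)))}.
Proof.
pose Q (i : nat) w := if (choice.unpickle i : option (seq (rat * nat * 'rV[rat]_d))) is Some s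
  then tends (fun n => avg n (@tents R d s) w)
    (Rintegral P1 setT (fun w => @tents R d s (Lambda w)))
  else True.
have aeQ i : {ae P, forall w, Q i w}.
  rewrite /Q; case: choice.unpickle => [s|]; last exact: aeW.
  exact: avg_tends_tents.
have := ae_foralln aeQ; apply: filterS => w H.
have {}H s : tends (fun n => avg n (@tents R d s) w)
    (Rintegral P1 setT (fun w => @tents R d s (Lambda w))).
  by have := H (choice.pickle s); rewrite /Q choice.pickleK.
have lower (f : V -> R) (M e : R) : continuous f -> (forall y, 0 <= f y <= M) -> 0 < e ->
    exists N, forall n, (N <= n)%N ->
      Rintegral P1 setT (fun w => f (Lambda w)) - e <= avg n f w.
  move=> cf fM e0; have e20 : 0 < e / 2 by rewrite divr_gt0.
  have [s [sf sE]] := tents_approx P1 mL cf fM e20.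
  have [N HN] := H s _ e20; exists N => n /HN; rewrite ler_norml => /andP[h _].
  have : avg n (@tents R d s) w <= avg n f w.
    by rewrite ler_wpM2l ?invr_ge0//; apply: ler_sum => i _; exact: sf.
  lra.
move=> f cf [M fM] e e0.
have M0 : 0 <= M := le_trans (normr_ge0 _) (fM 0).
have bf : bm (fun w => f (Lambda w)).
  split; last by exists M.
  exact: (measurableT_comp (continuous_measurable_Rd cf) mL).
have fM' y : - M <= f y <= M by rewrite -ler_norml.
have c1 : continuous (fun y => f y + M).
  by move=> y; apply: (continuousD (cf y)); exact: cst_continuous.
have c2 : continuous (fun y => M - f y).
  by move=> y; apply: (continuousB _ (cf y)); exact: cst_continuous.
have b1 y : 0 <= f y + M <= 2 * M by have /andP[? ?] := fM' y; apply/andP; split; lra.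
have b2 y : 0 <= M - f y <= 2 * M by have /andP[? ?] := fM' y; apply/andP; split; lra.
have [N1 H1] := lower _ _ _ c1 b1 e0; have [N2 H2] := lower _ _ _ c2 b2 e0.
(* For [n = 0] the average of the constant [M] would be 0. *)
exists (maxn (maxn N1 N2) 1) => n; rewrite !geq_max => /andP[/andP[/H1 h1 /H2 h2] n0].
have n0' : n%:R != 0 :> R by rewrite pnatr_eq0 -lt0n.
have avgM : n%:R^-1 * \sum_(i < n) M = M.
  by rewrite sumr_const card_ord -(mulr_natl M) mulKf.
move: h1 h2; rewrite big_split/= sumrB mulrDr mulrBr avgM Ex_add//; last exact: bm_cst.
rewrite Ex_sub//; last exact: bm_cst.
rewrite !Ex_cst ler_norml => h1 h2; apply/andP; split; lra.
Qed.

End WeakLimit.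

Theorem theorem1 (R : realType) (d : nat)
  (* the generic step Delta, on its own probability space *)
  (d0 : measure_display) (Omega0 : measurableType d0) (P0 : probability Omega0 R)
  (Delta : Omega0 -> Rd R d)
  (* the main probability space, with the copies Delta_i and the U_n *)
  (dO : measure_display) (Omega : measurableType dO) (P : probability Omega R)
  (Deltas : nat -> Omega -> Rd R d) (U : nat -> Omega -> nat)
  (* the limit Lambda, on its own probability space *)
  (d1 : measure_display) (Omega1 : measurableType d1) (P1 : probability Omega1 R)
  (Lambda : Omega1 -> Rd R d) (alpha : R) :
  measurable_fun setT Delta ->
  (forall i, (1 <= i)%N -> measurable_fun setT (Deltas i)) ->
  (forall i (B : set (Rd R d)), (1 <= i)%N -> measurable B ->
     P (Deltas i @^-1` B) = P0 (Delta @^-1` B)) ->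
  (forall n, (2 <= n)%N -> measurable_fun setT (U n)) ->
  (forall n k, (2 <= n)%N -> (1 <= k <= n.-1)%N ->
     P (U n @^-1` [set k]) = ((n.-1)%:R^-1)%:E) ->
  mutually_independent P
    (fun j : nat + nat => match j with
                          | inl i => events_of (Deltas i.+1)
                          | inr n => events_of (U n.+2)
                          end) ->
  measurable_fun setT Lambda ->
  0 < alpha ->
  weak_cvg (fun n => pushforward P
              (fun w => ((n%:R `^ (- alpha)) *: \sum_(1 <= i < n.+1) (Deltas i w : 'rV[R]_d))
                 : Rd R d))
           (pushforward P1 Lambda) ->
  {ae P, forall w,
     weak_cvg (fun n => Theta ((ln n%:R) `^ alpha)
                 (mdiv (empirical (Xval (fun i => Deltas i w) (fun m => U m w)) n) n%:R))
              (pushforward P1 Lambda)}.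
Proof.
move=> mDelta mDs lawDs mU lawU indep mL alpha0 weakS.
pose E (f : 'rV[R]_d -> R) := Rintegral P0 setT (fun w => f (Delta w)).
have E_mean : is_mean E by exact: is_mean_law.
have lawD i (f : 'rV[R]_d -> R) : bl f ->
    Rintegral P setT (fun w => f (Deltas i.+1 w)) = E f.
  move=> bf; apply: (eq_law_Rintegral (mDs i.+1 isT) mDelta _ (bl_bm bf)) => B mB.
  exact: lawDs.
(* The convergence hypothesis is restated through iterates of the transition operator, the only form
   used by the argument. *)
have weak (f : 'rV[R]_d -> R) : bl f ->
    tends (fun n => trn E n (fun x => f (n%:R `^ (- alpha) *: x)) 0)
      (Rintegral P1 setT (fun w => f (Lambda w))).
  move=> bf; have [fM _] := bf; apply: cvg_tends.
  have := weakS f (bl_continuous bf) fM; rewrite integral_pushforward_Ex//; last exact: bl_bm.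
  move=> /fine_cvg; apply: cvg_trans; apply: near_eq_cvg; apply: nearW => n /=.
  have mS : measurable_fun setT (fun w => n%:R `^ (- alpha) *:
      \sum_(1 <= i < n.+1) (Deltas i w : 'rV[R]_d) : Rd R d).
    apply: measurable_Rd_scale; under eq_fun do rewrite big_add1/= big_mkord.
    by apply: measurable_Rd_sum => i; exact: mDs.
  rewrite integral_pushforward_Ex//=; last exact: bl_bm.
  exact: (Ex_sum_steps E_mean mDs mU lawD indep n (bl_dilate (n%:R `^ (- alpha)) bf)).
have := avg_tends_continuous mL
  (fun f rad => @avg_tends_compact _ _ _ _ P _ _ E E_mean mDs mU lawD lawU indep
     _ _ P1 Lambda alpha mL alpha0 weak f rad).
apply: filterS => w H f cf fM.
have bf : bm (f : Rd R d -> R) by split => //; exact: continuous_measurable_Rd.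
rewrite integral_pushforward_Ex//; apply: cvg_EFin.
  by apply: nearW => n; rewrite integral_Theta_empirical.
have := tends_cvg (H f cf fM); apply: cvg_trans; apply: near_eq_cvg; apply: nearW => n /=.
by rewrite integral_Theta_empirical.
Qed.
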